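(* Let $H$ be a separable infinite-dimensional Hilbert space and let $T \in B(H)$. The following are equivalent: (i) $T$ satisfies the hypothesis of the Hypercyclicity Criterion. (ii) $T$ is hereditarily hypercyclic with respect to some subsequence $\{n_k\}$ of the positive integers. (iii) The operator $\bigoplus_{i=1}^{\infty} T$ is hypercyclic on $\bigoplus_{i=1}^{\infty} H$. (iv) The left multiplication operator $L_T : B_2(H) \to B_2(H)$ is $\|\cdot\|_2$-hypercyclic. (v) For each pair $U, V$ of non-empty open subsets of $H$ and each neighborhood $W$ of zero in $H$, there is a positive integer $n$ such that both $T^{n}U \cap W \neq \emptyset$ and $T^{n}W \cap V \neq \emptyset$.
   Context: $B(H)$ is the algebra of bounded linear operators on $H$. Hypercyclicity Criterion: $T \in B(H)$ satisfies the hypothesis of the Hypercyclicity Criterion if there exist two dense subsets $Y$ and $Z$ of $H$ and a sequence $\{n_k\}_{k\ge 1}$ of positive integers such that: (1) $T^{n_k} y \to 0$ as $k\to\infty$ for every $y \in Y$; and (2) there exist functions $S_{n_k} : Z \to H$ (not assumed linear or continuous) such that for every $z \in Z$, $S_{n_k} z \to 0$ and $T^{n_k} S_{n_k} z \to z$ as $k \to \infty$. Hypercyclicity: a continuous linear operator $A$ on a separable topological vector space $X$ is hypercyclic if there is $x \in X$ such that the orbit $\{x, Ax, A^2x, \ldots\}$ is dense in $X$. A sequence $\{T_n\}_{n=1}^\infty$ of bounded linear operators on $H$ is hypercyclic if there is $x \in H$ such that $\{T_n x : n = 1, 2, \ldots\}$ is dense in $H$. Hereditary hypercyclicity: for a sequence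 $\{n_k\}$ of positive integers, $T$ is hereditarily hypercyclic with respect to $\{n_k\}$ if for every subsequence $\{n_{k_m}\}_m$ of $\{n_k\}$ the sequence of operators $\{T^{n_{k_m}}\}_m$ is hypercyclic. $\bigoplus_{i=1}^\infty H$ is the Hilbert space ($\ell^2$) direct sum of countably many copies of $H$, and $\bigoplus_{i=1}^\infty T$ acts on it as $T$ in each coordinate. $B_2(H)$ is the space of Hilbert–Schmidt operators on $H$, i.e. those $A\in B(H)$ with $\|A\|_2 = \left(\sum_{i=1}^\infty \|A e_i\|^2\right)^{1/2} < \infty$ for an orthonormal basis $\{e_i\}$ of $H$ (independent of the basis); it is a Hilbert space with norm $\|\cdot\|_2$. The left multiplication operator is $L_T(S) = TS$, which maps $B_2(H)$ to itself. It is $\|\cdot\|_2$-hypercyclic if there is $S \in B_2(H)$ such that $\{S, L_T S, L_T^2 S, \ldots\}$ is dense in $B_2(H)$ in the norm $\|\cdot\|_2$. *)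

(* Defs.v *)
From HB Require Import structures.
From mathcomp Require Import all_boot all_order all_algebra.
From mathcomp Require Import sesquilinear complex.
From mathcomp Require Import all_classical all_reals ereal topology normedtype.
From mathcomp Require Import sequences ring.

Set Implicit Arguments.
Unset Strict Implicit.
Unset Printing Implicit Defensive.

Import Order.TTheory GRing.Theory Num.Theory.
Import numFieldNormedType.Exports.

Local Open Scope classical_set_scope.
Local Open Scope ring_scope.
Local Open Scope complex_scope.

(* A Hilbert space may be real or complex: the scalars are R or R[i]. *)
Variant scalar_kind := real_scalars | complex_scalars.

Definition scalar_field (R : realType) (k : scalar_kind) : numFieldType :=
  match k with real_scalars => R | complex_scalars => R[i] end.

Section Scalars.
Variables (R : realType) (k : scalar_kind).

Definition conj_scalar : scalar_field R k -> scalar_field R k :=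
  match k with real_scalars => idfun | complex_scalars => @conjc R end.

Definition real_part : scalar_field R k -> R :=
  match k with real_scalars => idfun | complex_scalars => @complex.Re R end.

Definition of_real : R -> scalar_field R k :=
  match k with real_scalars => idfun | complex_scalars => real_complex R end.

(* Norms in a normedModType K take values in K; [rnorm] is the same norm read
   in R. *)
Definition rnorm (V : normedModType (scalar_field R k)) (x : V) : R :=
  real_part `|x|.

Lemma of_realK : cancel of_real real_part.
Proof. by rewrite /of_real /real_part /scalar_field; case: k. Qed.

Lemma of_realD a b : of_real (a + b) = of_real a + of_real b.
Proof.
by rewrite /of_real /scalar_field; case: k => //=; exact: (rmorphD (real_complex R)).
Qed.

Lemma of_realM a b : of_real (a * b) = of_real a * of_real b.
Proof.
by rewrite /of_real /scalar_field; case: k => //=; exact: (rmorphM (real_complex R)).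
Qed.

Lemma of_real0 : of_real 0 = 0.
Proof. by rewrite /of_real /scalar_field; case: k. Qed.

Lemma ler_of_real a b : (of_real a <= of_real b) = (a <= b).
Proof. by rewrite /of_real /scalar_field; case: k => //=; rewrite lecR. Qed.

Lemma real_partK (z : scalar_field R k) : 0 <= z -> of_real (real_part z) = z.
Proof.
move: z; rewrite /of_real /real_part /scalar_field; case: k => //= -[a b].
by rewrite lecE /= => /andP[/eqP -> _].
Qed.

Section Rnorm.
Variable V : normedModType (scalar_field R k).
Implicit Types x y : V.

Lemma rnormE x : of_real (rnorm x) = `|x|.
Proof. exact: real_partK. Qed.

Lemma rnorm_ge0 x : 0 <= rnorm x.
Proof. by rewrite -ler_of_real of_real0 rnormE. Qed.

Lemma ler_rnormD x y : rnorm (x + y) <= rnorm x + rnorm y.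
Proof. by rewrite -ler_of_real of_realD !rnormE ler_normD. Qed.

Lemma rnormZ (a : scalar_field R k) x : rnorm (a *: x) = real_part `|a| * rnorm x.
Proof.
apply: (can_inj of_realK).
by rewrite of_realM !rnormE real_partK ?normrZ.
Qed.

Lemma rnorm0_eq0 x : rnorm x = 0 -> x = 0.
Proof. by move=> x0; apply: normr0_eq0; rewrite -rnormE x0 of_real0. Qed.

End Rnorm.
End Scalars.

Arguments of_real {R} k.
Arguments conj_scalar {R} k.

Section SquareSum.
Variables (R : realType) (k : scalar_kind) (H : normedModType (scalar_field R k)).
Implicit Types x y : nat -> H.

Definition sqsum x : \bar R := (\sum_(0 <= i <oo) (rnorm (x i) ^+ 2)%:E)%E.

Definition l2norm x : R := Num.sqrt (fine (sqsum x)).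

Lemma sqsum_ge0 x : (0 <= sqsum x)%E.
Proof. by apply: nneseries_ge0 => i _ _; rewrite lee_fin sqr_ge0. Qed.

Lemma sqsum_fin x : (sqsum x < +oo)%E -> sqsum x = ((l2norm x) ^+ 2)%:E.
Proof.
move=> xoo; rewrite sqr_sqrtr ?fine_ge0 ?sqsum_ge0// fineK//.
by rewrite ge0_fin_numE ?sqsum_ge0.
Qed.

Lemma l2norm_le x (c : R) : 0 <= c -> (sqsum x <= (c ^+ 2)%:E)%E -> l2norm x <= c.
Proof.
move=> c0 xc; have xoo : (sqsum x < +oo)%E by rewrite (le_lt_trans xc) ?ltry.
move: xc; rewrite sqsum_fin// lee_fin.
by rewrite ler_pXn2r ?nnegrE ?sqrtr_ge0.
Qed.

Lemma sqsumD x y (t : R) : 0 < t ->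
  (sqsum (x + y)%R <= (1 + t)%:E * sqsum x + (1 + t^-1)%:E * sqsum y)%E.
Proof.
move=> t0; have t1 : 0 <= 1 + t by rewrite addr_ge0 ?ltW.
have t'1 : 0 <= 1 + t^-1 by rewrite addr_ge0 // invr_ge0 ltW.
rewrite /sqsum -!nneseriesZl; try by move=> i _; rewrite lee_fin sqr_ge0.
rewrite -nneseriesD; last 2 first.
- by move=> i _ _; rewrite mule_ge0 ?lee_fin ?sqr_ge0.
- by move=> i _ _; rewrite mule_ge0 ?lee_fin ?sqr_ge0.
apply: lee_nneseries => i _; first by move=> _; rewrite lee_fin sqr_ge0.
rewrite -!EFinM -EFinD lee_fin.
set a := rnorm (x i); set b := rnorm (y i).
apply: (@le_trans _ _ ((a + b) ^+ 2)).
  rewrite lerXn2r ?nnegrE ?rnorm_ge0 ?addr_ge0 ?rnorm_ge0//; exact: ler_rnormD.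
have h : 0 <= t^-1 * (t * a - b) ^+ 2 by rewrite mulr_ge0 ?sqr_ge0 ?invr_ge0 ?ltW.
have -> : (1 + t) * a ^+ 2 + (1 + t^-1) * b ^+ 2
        = (a + b) ^+ 2 + t^-1 * (t * a - b) ^+ 2.
  by field; rewrite gt_eqF.
by rewrite lerDl.
Qed.

Lemma sqsumD_fin x y :
  (sqsum x < +oo)%E -> (sqsum y < +oo)%E -> (sqsum (x + y)%R < +oo)%E.
Proof.
move=> xoo yoo; apply: le_lt_trans (sqsumD x y ltr01) _.
by rewrite (sqsum_fin xoo) (sqsum_fin yoo) -!EFinM -EFinD ltry.
Qed.

Lemma sqsum0 x : sqsum x = 0%E -> x = 0.
Proof.
move=> x0; apply/funext => i; apply: rnorm0_eq0; apply/eqP.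
rewrite -sqrf_eq0 eq_le sqr_ge0 andbT -lee_fin.
have <- : sqsum x = 0%:E by [].
rewrite /sqsum (@nneseriesD1 _ _ i xpredT)//.
  by rewrite leeDl// nneseries_ge0// => j _ _; rewrite lee_fin sqr_ge0.
by move=> j _; rewrite lee_fin sqr_ge0.
Qed.

Lemma sqsumZ (a : scalar_field R k) x :
  (sqsum (a *: x)%R = (real_part `|a|%R ^+ 2)%:E * sqsum x)%E.
Proof.
rewrite /sqsum -nneseriesZl; last by move=> i _; rewrite lee_fin sqr_ge0.
by apply: eq_eseriesr => i _; rewrite -EFinM -exprMn -rnormZ.
Qed.

Lemma l2normD x y : (sqsum x < +oo)%E -> (sqsum y < +oo)%E ->
  l2norm (x + y) <= l2norm x + l2norm y.
Proof.
move=> xoo yoo; have [x0|x0] := eqVneq (l2norm x) 0.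
  have -> : x = 0 by apply: sqsum0; rewrite sqsum_fin// x0 expr0n.
  by rewrite add0r lerDr sqrtr_ge0.
have [y0|y0] := eqVneq (l2norm y) 0.
  have -> : y = 0 by apply: sqsum0; rewrite sqsum_fin// y0 expr0n.
  by rewrite addr0 lerDl sqrtr_ge0.
have xp : 0 < l2norm x by rewrite lt_neqAle eq_sym x0 sqrtr_ge0.
have yp : 0 < l2norm y by rewrite lt_neqAle eq_sym y0 sqrtr_ge0.
apply: l2norm_le; first by rewrite addr_ge0 ?sqrtr_ge0.
apply: le_trans (sqsumD x y (divr_gt0 yp xp)) _.
rewrite (sqsum_fin xoo) (sqsum_fin yoo) -!EFinM -EFinD lee_fin.
rewrite le_eqVlt; apply/orP; left; apply/eqP; field.
by rewrite x0 y0.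
Qed.

Lemma l2normZ (a : scalar_field R k) x : (sqsum x < +oo)%E ->
  l2norm (a *: x) = real_part `|a| * l2norm x.
Proof.
move=> xoo; have a0 : 0 <= real_part `|a|.
  by rewrite -(ler_of_real k) real_partK ?of_real0.
rewrite {1}/l2norm sqsumZ sqsum_fin//= -exprMn sqrtr_sqr ger0_norm//.
by rewrite mulr_ge0// sqrtr_ge0.
Qed.

Lemma l2norm0 x : (sqsum x < +oo)%E -> l2norm x = 0 -> x = 0.
Proof. by move=> xoo x0; apply: sqsum0; rewrite sqsum_fin// x0 expr0n. Qed.

Lemma sqsum_cst0 : sqsum 0 = 0%E.
Proof.
have -> : (0 : nat -> H) = (0 : scalar_field R k) *: (0 : nat -> H) by rewrite scale0r.
rewrite sqsumZ normr0 -[X in real_part X](of_real0 R k) of_realK expr0n.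
by rewrite mul0e.
Qed.

(* The l^2 direct sum of countably many copies of H, normed by l2norm. *)
Record l2sum := L2sum { l2_val :> nat -> H; _ : (sqsum l2_val < +oo)%E }.

HB.instance Definition _ := [isSub for l2_val].
HB.instance Definition _ := [Choice of l2sum by <:].

Let l2sum_submod : GRing.submod_closed [pred x : nat -> H | (sqsum x < +oo)%E].
Proof.
split=> [|a x y]; rewrite !inE; first by rewrite sqsum_cst0 ltry.
move=> xoo yoo; apply: sqsumD_fin => //.
by rewrite sqsumZ (sqsum_fin xoo) -EFinM ltry.
Qed.

HB.instance Definition _ :=
  GRing.SubChoice_isSubLmodule.Build (scalar_field R k) _ _ l2sum l2sum_submod.

Let l2sum_norm (x : l2sum) : scalar_field R k := of_real k (l2norm x).

Let l2sum_normD (x y : l2sum) : l2sum_norm (x + y) <= l2sum_norm x + l2sum_norm y.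
Proof.
rewrite -of_realD ler_of_real; exact: (l2normD (valP x) (valP y)).
Qed.

Let l2sum_normZ (a : scalar_field R k) (x : l2sum) :
  l2sum_norm (a *: x) = `|a| * l2sum_norm x.
Proof.
rewrite /l2sum_norm -[X in X * _]real_partK// -of_realM.
by congr of_real; exact: (l2normZ a (valP x)).
Qed.

Let l2sum_norm0 (x : l2sum) : l2sum_norm x = 0 -> x = 0.
Proof.
move=> x0; apply: val_inj => /=; apply: (l2norm0 (valP x)).
by apply: (can_inj (@of_realK R k)); rewrite of_real0.
Qed.

HB.instance Definition _ := Lmodule_isNormed.Build (scalar_field R k) l2sum
  l2sum_normD l2sum_normZ l2sum_norm0.

Lemma l2sum_normE (x : l2sum) : `|x| = of_real k (l2norm x).
Proof. by []. Qed.

End SquareSum.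


Section DirectSumOperator.
Variables (R : realType) (k : scalar_kind) (H : normedModType (scalar_field R k)).
Variables (T : {linear H -> H}) (cT : continuous T).

Lemma sqsum_comp (x : nat -> H) :
  (sqsum x < +oo)%E -> (sqsum (T \o x) < +oo)%E.
Proof.
move=> xoo; have /linear_boundedP := (linear_bounded_continuous T).2 cT.
move=> /pinfty_ex_gt0[M M0 TM].
apply: (@le_lt_trans _ _ ((real_part M ^+ 2)%:E * sqsum x)%E); last first.
  by rewrite (sqsum_fin xoo) -EFinM ltry.
rewrite /sqsum -nneseriesZl; last by move=> i _; rewrite lee_fin sqr_ge0.
apply: lee_nneseries => i _; first by move=> _; rewrite lee_fin sqr_ge0.
rewrite -EFinM lee_fin -exprMn lerXn2r ?nnegrE ?rnorm_ge0//.
  rewrite mulr_ge0 ?rnorm_ge0//.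
  by rewrite -(ler_of_real k) real_partK ?of_real0 ?ltW.
rewrite -(ler_of_real k) of_realM !rnormE (real_partK (ltW M0)); exact: TM.
Qed.

Definition l2sum_op (x : l2sum H) : l2sum H :=
  L2sum (sqsum_comp (valP x)).

End DirectSumOperator.

Section HilbertSchmidt.
Variables (R : realType) (k : scalar_kind) (H : normedModType (scalar_field R k)).
Variable dot : {dot H for conj_scalar k}.

Definition orthonormal_basis (e : nat -> H) :=
  (forall i j, dot (e i) (e j) = (i == j)%:R) /\
  dense [set x | exists n (c : nat -> scalar_field R k), x = \sum_(i < n) c i *: e i].

Record onb := Onb { onb_seq :> nat -> H; onbP : orthonormal_basis onb_seq }.

Variable e : onb.

Definition hilbert_schmidt (A : H -> H) :=
  [/\ linear A, continuous A & (sqsum (A \o e) < +oo)%E].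

(* The space and its norm, sqrt (\sum_i `|A e_i|^2), are written with a given
   orthonormal basis e; mathematically they do not depend on it. *)
Record hs := HS { hs_fun :> H -> H; _ : `[< hilbert_schmidt hs_fun >] }.

HB.instance Definition _ := [isSub for hs_fun].
HB.instance Definition _ := [Choice of hs by <:].

Lemma hsP (A : hs) : hilbert_schmidt A.
Proof. exact/asboolP/(valP A). Qed.

Let hs_submod : GRing.submod_closed [pred A : H -> H | `[< hilbert_schmidt A >]].
Proof.
split=> [|a A B]; rewrite !inE.
  split.
  - by move=> a x y; rewrite /= scaler0 addr0.
  - exact: cst_continuous.
  - by rewrite (_ : _ \o _ = 0 :> (nat -> H)) ?sqsum_cst0 ?ltry.
move=> [lA cA Aoo] [lB cB Boo]; split.
- move=> b x y /=; rewrite !fctE lA lB !scalerDr !scalerA (mulrC a).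
  by rewrite addrACA.
- by move=> x; apply: cvgD; [apply: cvgZr; exact: cA|exact: cB].
- rewrite [X in sqsum X](_ : _ = a *: (A \o e) + (B \o e)); last exact/funext.
  by apply: sqsumD_fin => //; rewrite sqsumZ (sqsum_fin Aoo) -EFinM ltry.
Qed.

HB.instance Definition _ :=
  GRing.SubChoice_isSubLmodule.Build (scalar_field R k) _ _ hs hs_submod.

Let hs_norm (A : hs) : scalar_field R k := of_real k (l2norm (A \o e)).

Let hs_normD (A B : hs) : hs_norm (A + B) <= hs_norm A + hs_norm B.
Proof.
have [[_ _ Aoo] [_ _ Boo]] := (hsP A, hsP B).
by rewrite -of_realD ler_of_real; exact: l2normD.
Qed.

Let hs_normZ (a : scalar_field R k) (A : hs) : hs_norm (a *: A) = `|a| * hs_norm A.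
Proof.
have [_ _ Aoo] := hsP A.
by rewrite /hs_norm [X in l2norm X](_ : _ = a *: (A \o e)) // l2normZ// of_realM real_partK.
Qed.

Let hs_norm0 (A : hs) : hs_norm A = 0 -> A = 0.
Proof.
have [lA cA Aoo] := hsP A; move=> A0.
have {}A0 : (A \o e : nat -> H) = 0.
  by apply: l2norm0 => //; apply: (can_inj (@of_realK R k)); rewrite of_real0.
apply: val_inj; apply/funext => x /=; apply: contrapT => Ax.
have oA : open [set y | A y != 0].
  rewrite (_ : [set y | _] = A @^-1` ~` [set 0]).
    apply: open_comp; first by move=> y _; exact: cA.
    apply: closed_openC; apply: accessible_closed_set1.
    apply: hausdorff_accessible; exact: norm_hausdorff.
  by apply/seteqP; split=> y /= /eqP.
have [] := (onbP e).2 [set y | A y != 0]; last 1 first.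
- move=> _ [/[swap] [[n [c ->]]]] /=.
  have A00 : A 0 = 0 by have := lA (-1) 0 0; rewrite scaler0 addr0 scaleN1r addNr.
  elim: n => [|n ih]; first by rewrite big_ord0 A00 eqxx.
  rewrite big_ord_recr/= addrC lA => /negP; apply.
  have /(congr1 (fun f => f n)) /= -> := A0.
  by rewrite scaler0 add0r; apply/negPn/negP => /ih.
- by exists x; apply/eqP.
- exact: oA.
Qed.

HB.instance Definition _ := Lmodule_isNormed.Build (scalar_field R k) hs
  hs_normD hs_normZ hs_norm0.

Lemma hs_normE (A : hs) : `|A| = of_real k (l2norm (A \o e)).
Proof. by []. Qed.

Variables (T : {linear H -> H}) (cT : continuous T).

Lemma hilbert_schmidt_comp (A : hs) : `[< hilbert_schmidt (T \o A) >].
Proof.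
have [lA cA Aoo] := hsP A; apply/asboolP; split.
- by move=> a x y /=; rewrite lA linearP.
- by move=> x; apply: continuous_comp; [exact: cA|exact: cT].
- exact: (sqsum_comp cT Aoo).
Qed.

Definition hs_lmul (A : hs) : hs := HS (hilbert_schmidt_comp A).

End HilbertSchmidt.

Arguments hs_lmul {R k H dot} e {T} cT A.

Section Hypercyclicity.
Variable X : topologicalType.

Definition hypercyclic_seq (T_ : nat -> X -> X) :=
  exists x, dense (range (fun m => T_ m x)).

Definition hypercyclic (A : X -> X) := exists x, dense (range (fun m => iter m A x)).

Definition hereditarily_hypercyclic (A : X -> X) (n : nat -> nat) :=
  forall m : nat -> nat, {homo m : i j / (i < j)%N} ->
    hypercyclic_seq (fun i => iter (n (m i)) A).

End Hypercyclicity.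

Section Criterion.
Variables (K : numDomainType) (V : normedModType K).

(* The functions S_(n_k) : Z -> H are given as total functions S (n k), of which
   only the values on Z matter. *)
Definition hypercyclicity_criterion (T : V -> V) :=
  exists (Y Z : set V) (n : nat -> nat),
    [/\ dense Y, dense Z, forall k, (0 < n k)%N,
        forall y, Y y -> iter (n k) T y @[k --> \oo] --> (0 : V)
      & exists S : nat -> V -> V, forall z, Z z ->
          S (n k) z @[k --> \oo] --> (0 : V) /\
          iter (n k) T (S (n k) z) @[k --> \oo] --> z].

End Criterion.

Definition separable (X : topologicalType) :=
  exists2 D : set X, countable D & dense D.

Definition infinite_dimensional (K : numDomainType) (V : lmodType K) :=
  forall s : seq V, exists x, forall c : nat -> K,
    x <> \sum_(i < size s) c i *: s`_i.

(* Main.v *)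
(** Hypercyclic vectors come from Baire's theorem, and all estimates are carried out
in [R] through [rnorm], so that real and complex scalars are treated at once.
- (i) => (ii): the criterion makes T topologically transitive along every
  subsequence of a strictly increasing sequence extracted from (n_k).
- (ii) => (iii): a hypercyclic vector x along a subsequence yields the hypercyclic
  vectors T^p x, so the powers T^(n_k) are mixing.  Finitely many coordinates can
  therefore be steered simultaneously, which makes the direct sum transitive.
- (iii) <=> (iv): for an orthonormal basis (e_i), A |-> (A e_i)_i is an isometry
  of B_2(H) onto the direct sum which conjugates L_T to the direct sum of T.
- (iii) => (v): look at two coordinates of a hypercyclic vector.
- (v) => (i): by Baire there is a vector x with dense orbit for which there are
  n_k and u_k with T^(n_k) x -> 0, u_k -> 0 and T^(n_k) u_k -> x.  The criterion
  holds with Y = Z = {T^m x} and S_(n_k) (T^m x) = T^m u_k. *)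

Require Import Defs.
From mathcomp Require Import all_boot all_order all_algebra.
From mathcomp Require Import sesquilinear complex.
From mathcomp Require Import all_classical all_reals ereal topology normedtype.
From mathcomp Require Import sequences lra.

Set Implicit Arguments.
Unset Strict Implicit.
Unset Printing Implicit Defensive.

Import Order.TTheory GRing.Theory Num.Theory.
Import numFieldNormedType.Exports.

Local Open Scope classical_set_scope.
Local Open Scope ring_scope.

(** * The real-valued norm and Baire's theorem *)

Section RealNorm.
Variables (R : realType) (k : scalar_kind).
Notation K := (scalar_field R k).

Lemma ex_invn_lt (d : R) : 0 < d -> exists N : nat, N.+1%:R^-1 < d.
Proof.
move=> d0; exists (Num.bound d^-1); rewrite invf_plt ?posrE ?ltr0n//.
have d'0 : 0 <= d^-1 by rewrite invr_ge0 ltW.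
by rewrite (lt_le_trans (archi_boundP d'0))// ler_nat.
Qed.

Lemma ltr_of_real (a b : R) : (of_real k a < of_real k b) = (a < b).
Proof. by rewrite !lt_neqAle ler_of_real (inj_eq (can_inj (@of_realK R k))). Qed.

Lemma real_part_gt0 (e : K) : 0 < e -> 0 < real_part e.
Proof. by move=> e0; rewrite -ltr_of_real of_real0 real_partK ?ltW. Qed.

Lemma conj_scalar_ge0 (a : K) : 0 <= a -> conj_scalar k a = a.
Proof.
rewrite /conj_scalar /scalar_field in a *; case: k a => //= -[x y].
by rewrite lecE /= => /andP[/eqP -> _]; rewrite oppr0.
Qed.

Lemma mul_conj_scalar (a : K) : a * conj_scalar k a = `|a| ^+ 2.
Proof.
rewrite /conj_scalar /scalar_field in a *; case: k a => /= a.
  by rewrite real_normK ?num_real.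
by rewrite sqr_normc.
Qed.

Variable V : normedModType K.
Implicit Types (x y z : V) (e : R).

Lemma rnorm0 : rnorm (0 : V) = 0.
Proof. by apply: (can_inj (@of_realK R k)); rewrite rnormE normr0 of_real0. Qed.

Lemma rnormN x : rnorm (- x) = rnorm x.
Proof. by rewrite /rnorm normrN. Qed.

Lemma rdistC x y : rnorm (x - y) = rnorm (y - x).
Proof. by rewrite -rnormN opprB. Qed.

Lemma rdist_triangle y x z : rnorm (x - z) <= rnorm (x - y) + rnorm (y - z).
Proof. by rewrite (le_trans _ (ler_rnormD _ _))// addrA subrK. Qed.

Lemma rdist_lt y x z (a b c : R) :
  rnorm (x - y) < a -> rnorm (y - z) < b -> a + b <= c -> rnorm (x - z) < c.
Proof. by have := rdist_triangle y x z; lra. Qed.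

Lemma rnorm_sum (I : Type) (s : seq I) (P : pred I) (f : I -> V) :
  rnorm (\sum_(i <- s | P i) f i) <= \sum_(i <- s | P i) rnorm (f i).
Proof.
elim/big_ind2 : _ => //; first by rewrite rnorm0.
by move=> x1 x2 y1 y2 h1 h2; rewrite (le_trans (ler_rnormD _ _))// lerD.
Qed.

Lemma rnorm_gt0 x : x != 0 -> 0 < rnorm x.
Proof.
move=> x0; rewrite lt_neqAle rnorm_ge0 andbT eq_sym.
by apply: contra_neq x0 => /rnorm0_eq0.
Qed.

Lemma nbhs_rnormP x (A : set V) :
  nbhs x A <-> exists2 e, 0 < e & forall y, rnorm (y - x) < e -> A y.
Proof.
split=> [/nbhs_ballP[e /= e0 eA]|[e e0 eA]].
  exists (real_part e) => [|y ye]; first exact: real_part_gt0.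
  apply: eA; rewrite -ball_normE /= distrC -rnormE -(real_partK (ltW e0)).
  by rewrite ltr_of_real.
apply/nbhs_ballP; exists (of_real k e) => /=.
  by rewrite -[0](of_real0 R k) ltr_of_real.
by move=> y; rewrite -ball_normE /= distrC -rnormE ltr_of_real => /eA.
Qed.

Lemma open_rnormP (A : set V) : open A <->
  forall x, A x -> exists2 e, 0 < e & forall y, rnorm (y - x) < e -> A y.
Proof.
rewrite openE; split=> [oA x /oA|oA x Ax]; first by move/nbhs_rnormP.
exact/nbhs_rnormP/oA.
Qed.

Definition rball x e : set V := [set y | rnorm (y - x) < e].

Lemma rball_open x e : open (rball x e).
Proof.
apply/open_rnormP => y; rewrite /rball /= => ye.
exists (e - rnorm (y - x)) => [|z zy]; first by rewrite subr_gt0.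
by rewrite (le_lt_trans (rdist_triangle y _ _))// -ltrBrDr.
Qed.

Lemma rball_center x e : 0 < e -> rball x e x.
Proof. by rewrite /rball /= subrr rnorm0. Qed.

Lemma dense_rnormP (D : set V) :
  dense D <-> forall x e, 0 < e -> exists2 y, D y & rnorm (y - x) < e.
Proof.
split=> [dD x e e0|dD A [x Ax] /open_rnormP oA].
  have [|y [ye Dy]] := dD _ _ (rball_open x e); last by exists y.
  by exists x; exact: rball_center.
have [e e0 eA] := oA _ Ax; have [y Dy ye] := dD x e e0.
by exists y; split => //; exact: eA.
Qed.

Lemma cvg_rnormP (u : nat -> V) (l : V) : (u n @[n --> \oo] --> l) <->
  forall e, 0 < e -> exists N, forall n, (N <= n)%N -> rnorm (u n - l) < e.
Proof.
split=> [ul e e0|ul].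
  have /ul[N _ NA] : nbhs l (rball l e) by apply/nbhs_rnormP; exists e.
  by exists N => n Nn; exact: NA.
move=> A /nbhs_rnormP[e e0 eA]; have [N NA] := ul _ e0.
by exists N => // n Nn; apply: eA; exact: NA.
Qed.

End RealNorm.

Section Linear.
Variables (R : realType) (k : scalar_kind).
Notation K := (scalar_field R k).
Variables V W : normedModType K.

Lemma continuous_rnormP (f : V -> W) : continuous f <->
  forall x (e : R), 0 < e -> exists2 d : R, 0 < d &
    forall y, rnorm (y - x) < d -> rnorm (f y - f x) < e.
Proof.
split=> [cf x e e0|cf x A /nbhs_rnormP[e e0 eA]].
  have /cf/nbhs_rnormP// : nbhs (f x) (rball (f x) e).
  by apply/nbhs_rnormP; exists e.
apply/nbhs_rnormP; have [d d0 df] := cf x e e0.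
by exists d => // y /df /eA.
Qed.

End Linear.

(** * Baire category and transitivity *)

Section Baire.
Variables (R : realType) (k : scalar_kind).
Notation K := (scalar_field R k).
Variable V : normedModType K.

(** Phrased through [rnorm] so that it serves both [H] and [l2sum H], whose completeness is proved
    below. Comparison with [u N] alone gives the usual Cauchy condition by the triangle
    inequality. *)
Definition sequentially_complete := forall u : nat -> V,
  (forall e : R, 0 < e ->
    exists N, forall n, (N <= n)%N -> rnorm (u n - u N) < e) ->
  exists l : V, u n @[n --> \oo] --> l.

Hypothesis cV : sequentially_complete.

(** Nested closed balls, the n-th one inside the n-th open set, have radii tending to 0, and their
    centres converge to a point of all of them. An arbitrary countable index type lets several
    families of conditions be imposed at once. *)
Lemma baire (J : countType) (F : J -> set V) :
  (forall i, open (F i) /\ dense (F i)) -> dense (\bigcap_i F i).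
Proof.
(* Numbers that encode no index impose no condition. *)
move=> Fod; pose G n := if @unpickle J n is Some i then F i else setT.
have God n : open (G n) /\ dense (G n).
  rewrite /G; case: unpickle => [i//|]; split; first exact: openT.
  by move=> A A0 _; rewrite setIT.
have step (np : nat * (V * R)) : exists q : V * R, 0 < np.2.2 ->
    [/\ 0 < q.2, q.2 <= np.1.+1%:R^-1 & forall y, rnorm (y - q.1) <= q.2 ->
      G np.1 y /\ rnorm (y - np.2.1) < np.2.2].
  case: np => n [x r] /=; have [r0|r0] := boolP (0 < r); last by exists (x, r).
  have [/open_rnormP oG /dense_rnormP /(_ x r r0)[y Gy yr]] := God n.
  have [e e0 eG] := oG _ Gy.
  (* The first bound keeps the closed ball in [G n], the second keeps it in the previous open ball,
     and the third makes the centres Cauchy. *)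
  pose d := Num.min (e / 2) (Num.min ((r - rnorm (y - x)) / 2) n.+1%:R^-1).
  exists (y, d) => _ /=; split.
  - by rewrite /d !lt_min invr_gt0 ltr0n andbT !divr_gt0 ?subr_gt0.
  - by rewrite /d !ge_min lexx !orbT.
  - move=> z zd; have de : d <= e / 2 by rewrite /d ge_min lexx.
    have dr : d <= (r - rnorm (y - x)) / 2 by rewrite /d !ge_min lexx orbT.
    split; first by apply: eG; lra.
    by have := rdist_triangle y z x; lra.
have [f fP] := choice step.
apply/dense_rnormP => x e e0.
(* Starting with radius [e / 2] puts the limit strictly within [e] of [x]. *)
pose s n := iteri n (fun i p => f (i, p)) (x, e / 2).
have s0 n : 0 < (s n).2.
  by elim: n => [|n /= ih]; [rewrite /= divr_gt0|case: (fP (n, s n) ih)].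
have sS n y : rnorm (y - (s n.+1).1) <= (s n.+1).2 ->
    G n y /\ rnorm (y - (s n).1) < (s n).2.
  by case: (fP (n, s n) (s0 n)) => _ _; apply.
have s_le d n y : rnorm (y - (s (n + d)%N).1) <= (s (n + d)%N).2 ->
    rnorm (y - (s n).1) <= (s n).2.
  by elim: d => [|d ih]; rewrite ?addn0// addnS => /sS[_ /ltW /ih].
have sn n m : (n <= m)%N -> rnorm ((s m).1 - (s n).1) <= (s n).2.
  move=> nm; apply: (s_le (m - n)%N); rewrite subnKC// subrr rnorm0.
  exact/ltW.
have [|l sl] := cV (u := fun n => (s n).1).
  move=> d d0; have [N Nd] := ex_invn_lt d0.
  exists N.+1 => n /sn /le_lt_trans; apply; apply: le_lt_trans Nd.
  by case: (fP (N, s N) (s0 N)).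
have ls n : rnorm (l - (s n).1) <= (s n).2.
  apply/ler_addgt0Pr => d d0; move/cvg_rnormP : sl => /(_ _ d0)[N Nd].
  have := rdist_triangle (s (maxn N n)).1 l (s n).1.
  have := sn n (maxn N n) (leq_maxr _ _).
  by have := Nd (maxn N n) (leq_maxl _ _); rewrite rdistC; lra.
exists l; last by have := ls 0%N => /=; lra.
by move=> i _; have [] := sS (pickle i) l (ls _); rewrite /G pickleK.
Qed.

Lemma hits_open (F : nat -> V -> V) (A : set V) :
  (forall m, continuous (F m)) -> open A -> open (\bigcup_m F m @^-1` A).
Proof.
by move=> cF oA; apply: bigcup_open => m _; exact: open_comp.
Qed.

(** Balls of radius 1/(j+1) about a dense family suffice to test density. When the family is
    countable, these are countably many open conditions on [x], as Baire's theorem requires. *)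
Lemma dense_orbit (J : Type) (d : J -> V) (F : nat -> V -> V) x :
  dense (range d) ->
  (forall i j, (\bigcup_m F m @^-1` rball (d i) j.+1%:R^-1) x) ->
  dense (range (fun m => F m x)).
Proof.
move=> /dense_rnormP dd Fx; apply/dense_rnormP => y e e0.
have e20 : 0 < e / 2 by rewrite divr_gt0.
have [_ [i _ <-] iy] := dd y _ e20.
have [N Ne] := ex_invn_lt e20.
have [m _] := Fx i N; rewrite /preimage /rball /= => Fm.
exists (F m x); first by exists m.
by apply: (rdist_lt Fm iy); rewrite [leRHS]splitr lerD2r; exact: ltW.
Qed.

(* Birkhoff's transitivity theorem. *)
Lemma transitive_hypercyclic_seq (J : countType) (d : J -> V)
    (F : nat -> V -> V) : dense (range d) -> (forall m, continuous (F m)) ->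
  (forall A B : set V, open A -> A !=set0 -> open B -> B !=set0 ->
    exists m x, A x /\ B (F m x)) ->
  hypercyclic_seq F.
Proof.
move=> dd cF trF.
have dG : dense (\bigcap_(p : J * nat)
    \bigcup_m F m @^-1` rball (d p.1) p.2.+1%:R^-1).
  apply: baire => p; split; first exact/hits_open/rball_open.
  move=> A A0 oA.
  have [|m [x [Ax Fx]]] := trF A _ oA A0 (rball_open (d p.1) p.2.+1%:R^-1).
    by exists (d p.1); apply: rball_center; rewrite invr_gt0 ltr0n.
  by exists x; split=> //; exists m.
have [||x [_ Gx]] := dG setT; [by exists 0|exact: openT|].
by exists x; apply: (dense_orbit dd) => i j; exact: (Gx (i, j)).
Qed.

End Baire.

Section Complete.
Variables (R : realType) (k : scalar_kind).
Notation K := (scalar_field R k).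

Lemma complete_sequentially (V : completeNormedModType K) :
  sequentially_complete V.
Proof.
move=> u uC; apply/cvg_ex/cauchy_cvgP/cauchyP => e e0.
have [N NA] := uC _ (real_part_gt0 e0).
exists (u N); exists N => // n Nn; rewrite -ball_normE /= distrC -rnormE.
by rewrite -(real_partK (ltW e0)) ltr_of_real; exact: NA.
Qed.

End Complete.

(** * The l^2 direct sum *)

Lemma eventually_forall_ltn (P : nat -> nat -> Prop) :
  (forall i, exists N, forall n, (N <= n)%N -> P i n) ->
  forall m, exists N, forall n, (N <= n)%N -> forall i, (i < m)%N -> P i n.
Proof.
move=> evP; elim=> [|m [N NP]]; first by exists 0%N.
have [N' N'P] := evP m; exists (maxn N N') => n; rewrite geq_max => /andP[Nn N'n] i.
by rewrite ltnS leq_eqVlt => /orP[/eqP ->|]; [exact: N'P|exact: NP].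
Qed.

Section L2.
Variables (R : realType) (k : scalar_kind) (H : normedModType (scalar_field R k)).
Implicit Types (x y : l2sum H) (u v : nat -> H) (c e : R).

(** Trades the extended-real series for finite sums in [R], on which the norm estimates below are
    made. *)
Lemma sqsum_leP u c :
  (sqsum u <= c%:E)%E <-> forall n, \sum_(i < n) rnorm (u i) ^+ 2 <= c.
Proof.
have p0 i : (0 <= (rnorm (u i) ^+ 2)%:E)%E by rewrite lee_fin sqr_ge0.
split=> [uc n|uc].
  rewrite -lee_fin -sumEFin (le_trans _ uc)//.
  rewrite -(big_mkord xpredT (fun i => (rnorm (u i) ^+ 2)%:E)).
  by apply: nneseries_lim_ge.
apply: lime_le; first exact: is_cvg_nneseries.
by apply: nearW => n; rewrite sumEFin big_mkord lee_fin.
Qed.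

Lemma l2_rnormE x : rnorm x = l2norm x.
Proof. by rewrite /rnorm l2sum_normE of_realK. Qed.

Lemma l2_rnorm_leP x c : 0 <= c ->
  rnorm x <= c <-> forall n, \sum_(i < n) rnorm (x i) ^+ 2 <= c ^+ 2.
Proof.
move=> c0; rewrite -sqsum_leP (sqsum_fin (valP x)) lee_fin l2_rnormE.
by rewrite ler_pXn2r ?nnegrE ?sqrtr_ge0.
Qed.

Lemma l2_rnorm_le x n : \sum_(i < n) rnorm (x i) ^+ 2 <= rnorm x ^+ 2.
Proof. by move: n; apply/l2_rnorm_leP; rewrite ?rnorm_ge0. Qed.

Lemma rnorm_l2_val x i : rnorm (x i) <= rnorm x.
Proof.
rewrite -(@ler_pXn2r _ 2) ?nnegrE ?rnorm_ge0// (le_trans _ (l2_rnorm_le x i.+1))//.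
by rewrite big_ord_recr /= lerDr sumr_ge0// => j _; rewrite sqr_ge0.
Qed.

Lemma sum_trunc_le N u n :
  \sum_(i < n) rnorm (if (i < N)%N then u i else 0) ^+ 2 <=
  \sum_(i < N) rnorm (u i) ^+ 2.
Proof.
rewrite -(big_mkord xpredT (fun i => rnorm (if (i < N)%N then u i else 0) ^+ 2)).
rewrite -(big_mkord xpredT (fun i => rnorm (u i) ^+ 2)).
have le_trunc m : \sum_(0 <= i < m) rnorm (if (i < N)%N then u i else 0) ^+ 2 <=
    \sum_(0 <= i < m) rnorm (u i) ^+ 2.
  apply: ler_sum => i _; case: ifP => // _.
  by rewrite rnorm0 expr0n sqr_ge0.
have [nN|Nn] := leqP n N.
  rewrite (le_trans (le_trunc n))// [leRHS](big_cat_nat (leq0n _) nN)//= lerDl.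
  by rewrite sumr_ge0// => i _; exact: sqr_ge0.
rewrite (big_cat_nat (leq0n _) (ltnW Nn))//= [X in _ + X]big_nat_cond.
rewrite [X in _ + X]big1 ?addr0// => i /andP[/andP[Ni _] _].
by rewrite ltnNge Ni rnorm0 expr0n.
Qed.

Lemma l2_trunc_subproof N u :
  (sqsum (fun i => if (i < N)%N then u i else 0%R) < +oo)%E.
Proof.
apply: (@le_lt_trans _ _ (\sum_(i < N) rnorm (u i) ^+ 2)%:E); last by rewrite ltry.
by apply/sqsum_leP => n; exact: sum_trunc_le.
Qed.

(** The sequence [u] is arbitrary, not an element of [l2sum H], so that approximants can be chosen
    one coordinate at a time. *)
Definition l2_trunc N u : l2sum H := L2sum (l2_trunc_subproof N u).

Lemma l2_truncB N u v :
  l2_trunc N u - l2_trunc N v = l2_trunc N (fun i => u i - v i).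
Proof.
apply: val_inj; apply/funext => i /=; rewrite !fctE /=.
by case: ifP => //; rewrite subr0.
Qed.

Lemma rnorm_l2_trunc N u c : 0 <= c ->
  \sum_(i < N) rnorm (u i) ^+ 2 <= c ^+ 2 -> rnorm (l2_trunc N u) <= c.
Proof.
move=> c0 uc; apply/l2_rnorm_leP => // n; apply: le_trans uc.
exact: sum_trunc_le.
Qed.

(** The squares add up to at most N e^2/(N+1)^2. Dividing by [N.+1] covers the case [N = 0] as
    well. *)
Lemma rnorm_l2_trunc_le N u e : 0 <= e ->
  (forall i, (i < N)%N -> rnorm (u i) <= e / N.+1%:R) -> rnorm (l2_trunc N u) <= e.
Proof.
move=> e0 ue; apply: rnorm_l2_trunc => //.
have p0 : 0 < N.+1%:R :> R by rewrite ltr0n.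
apply: (@le_trans _ _ (\sum_(i < N) (e / N.+1%:R) ^+ 2)).
  apply: ler_sum => i _; rewrite lerXn2r ?nnegrE ?rnorm_ge0 ?ue//.
  by rewrite divr_ge0.
rewrite sumr_const card_ord -[leLHS]mulr_natl expr_div_n mulrCA.
rewrite ler_piMr ?sqr_ge0// ler_pdivrMr ?exprn_gt0// mul1r -natrX ler_nat.
by rewrite (leq_trans (leqnSn _))// leq_pmulr.
Qed.

Lemma l2_trunc_cvg x e : 0 < e ->
  exists N0, forall N, (N0 <= N)%N -> rnorm (l2_trunc N x - x) <= e.
Proof.
move=> e0; pose s n := \sum_(0 <= i < n) rnorm (x i) ^+ 2.
have s_homo : {homo s : n m / (n <= m)%N >-> n <= m}.
  move=> n m nm; rewrite /s (big_cat_nat (leq0n _) nm) //= lerDl.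
  by apply: sumr_ge0 => i _; rewrite sqr_ge0.
have sx n : s n <= rnorm x ^+ 2 by rewrite /s big_mkord l2_rnorm_le.
have supS : has_sup (range s).
  by split; [exists (s 0%N), 0%N|exists (rnorm x ^+ 2) => _ [n _ <-]].
have [_ [N0 _ <-] N0e] := sup_adherent (exprn_gt0 2 e0) supS.
exists N0 => N N0N; apply/l2_rnorm_leP => [|n]; first exact: ltW.
rewrite -(big_mkord xpredT (fun i => rnorm ((l2_trunc N x - x) i) ^+ 2)).
have tailE i : rnorm ((l2_trunc N x - x) i) ^+ 2 =
    if (i < N)%N then 0 else rnorm (x i) ^+ 2.
  have -> : (l2_trunc N x - x) i = (if (i < N)%N then x i else 0) - x i by [].
  by case: ifP => _; rewrite ?subrr ?sub0r ?rnormN // rnorm0 expr0n.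
(* Extending the sum to [maxn n N] turns it into a difference of partial sums of [x], which is less
   than [e ^+ 2] by the choice of [N0]. *)
have : \sum_(0 <= i < n) rnorm ((l2_trunc N x - x) i) ^+ 2 <= s (maxn n N) - s N.
  have -> : s (maxn n N) - s N =
      \sum_(0 <= i < maxn n N) rnorm ((l2_trunc N x - x) i) ^+ 2.
    rewrite /s (big_cat_nat (leq0n _) (leq_maxr n N))//= addrAC subrr add0r.
    rewrite [RHS](big_cat_nat (leq0n _) (leq_maxr n N))//=.
    rewrite [X in _ = X + _]big_nat_cond [X in _ = X + _]big1 ?add0r.
      rewrite big_nat_cond [RHS]big_nat_cond; apply: eq_bigr => i /andP[/andP[Ni _] _].
      by rewrite tailE ltnNge Ni.
    by move=> i /andP[/andP[_ iN] _]; rewrite tailE iN.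
  rewrite [leRHS](big_cat_nat (leq0n _) (leq_maxl n N))//= lerDl.
  by apply: sumr_ge0 => i _; rewrite sqr_ge0.
have := s_homo _ _ N0N.
have := ub_le_sup supS.2 (imageT s (maxn n N)).
by lra.
Qed.

Hypothesis cH : sequentially_complete H.

(** The candidate is the coordinatewise limit [y]. The Cauchy estimate passes to [y] on the first
    [m] coordinates, uniformly in [m], hence to the whole sequence. *)
Lemma l2sum_sequentially_complete : sequentially_complete (l2sum H).
Proof.
move=> u uC.
have /choice[y uy] i : exists y : H, u n i @[n --> \oo] --> y.
  apply: cH => e /uC[N Nu]; exists N => n /Nu.
  by apply: le_lt_trans; exact: (rnorm_l2_val (u n - u N) i).
have uyN e : 0 < e -> exists N, forall n, (N <= n)%N ->
    forall m, rnorm (l2_trunc m (fun i => u n i - y i)) <= e.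
  move=> e0; have e30 : 0 < e / 3 by rewrite divr_gt0.
  have [N Nu] := uC _ e30; exists N => n Nn m.
  have em0 : 0 < e / 3 / m.+1%:R by rewrite divr_gt0 ?ltr0n.
  have [M MP] := eventually_forall_ltn
    (fun i => (cvg_rnormP _ _).1 (uy i) _ em0) m.
  (* The index [p] depends on [m], but it disappears from the final bound, so [N] is uniform in
     [m]. *)
  pose p := maxn N M.
  have h1 : rnorm (l2_trunc m (u p) - l2_trunc m y) <= e / 3.
    rewrite l2_truncB; apply: rnorm_l2_trunc_le => [|i im]; first exact: ltW.
    by rewrite ltW// MP// leq_maxr.
  have h2 : rnorm (l2_trunc m (u n) - l2_trunc m (u p)) <= rnorm (u n - u p).
    rewrite l2_truncB; apply: rnorm_l2_trunc; first exact: rnorm_ge0.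
    exact: (l2_rnorm_le (u n - u p)).
  have h3 : rnorm (u n - u p) <= e / 3 + e / 3.
    apply: le_trans (rdist_triangle (u N) (u n) (u p)) _.
    apply: lerD; first exact/ltW/Nu.
    by rewrite rdistC; apply/ltW/Nu; exact: leq_maxl.
  rewrite -l2_truncB.
  apply: le_trans (rdist_triangle (l2_trunc m (u p)) _ _) _.
  by apply: le_trans (lerD (le_trans h2 h3) h1) _; lra.
have [N NP] := uyN _ ltr01.
have uyl2 n c : (forall m, rnorm (l2_trunc m (fun i => u n i - y i)) <= c) ->
    forall m, \sum_(i < m) rnorm (u n i - y i) ^+ 2 <= c ^+ 2.
  move=> uc m; apply: le_trans (lerXn2r 2 _ _ (uc m)); rewrite ?nnegrE ?rnorm_ge0//.
    apply: le_trans (l2_rnorm_le _ m); apply: ler_sum => i _.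
    by rewrite /= ltn_ord.
  exact: le_trans (rnorm_ge0 _) (uc m).
have zoo : (sqsum (fun i => (u N i - y i)%R) < +oo)%E.
  apply: le_lt_trans (ltry (1 ^+ 2)).
  by apply/sqsum_leP; exact: uyl2 (NP N (leqnn N)).
pose z : l2sum H := L2sum zoo.
(* This is [y] coordinatewise; written as a difference, it is square summable with no further
   proof. *)
exists (u N - z); apply/cvg_rnormP => e e0.
have [M MP] := uyN _ (divr_gt0 e0 (ltr0n _ 2)); exists M => n Mn.
apply: (@le_lt_trans _ _ (e / 2)); last by rewrite ltr_pdivrMr// ltr_pMr// ltr1n.
apply/l2_rnorm_leP => [|m]; first by rewrite divr_ge0// ltW.
apply: le_trans (uyl2 n _ (MP n Mn) m); apply: ler_sum => i _.
have -> : (u n - (u N - z)) i = u n i - (u N i - (u N i - y i)) by [].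
by rewrite subKr.
Qed.

(** Finitely supported vectors with entries in the dense sequence are indexed by the countable type
    [seq nat]: the length is the truncation level, the entries are indices into [h]. *)
Lemma l2sum_separable (h : nat -> H) : dense (range h) ->
  dense (range (fun s : seq nat => l2_trunc (size s) (fun i => h (nth 0%N s i)))).
Proof.
move=> /dense_rnormP dh; apply/dense_rnormP => x e e0.
have e30 : 0 < e / 3 by rewrite divr_gt0.
have [N NP] := l2_trunc_cvg x e30; have {}NP := NP N (leqnn N).
have em0 : 0 < e / 3 / N.+1%:R by rewrite divr_gt0 ?ltr0n.
have /choice[g gP] i : exists n, rnorm (h n - x i) < e / 3 / N.+1%:R.
  by have [_ [n _ <-]] := dh (x i) _ em0; exists n.
exists (l2_trunc N (fun i => h (g i))).
  exists (mkseq g N) => //; rewrite size_mkseq; apply: val_inj; apply/funext => i /=.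
  by case: ifP => // iN; rewrite nth_mkseq.
have hgx : rnorm (l2_trunc N (fun i => h (g i)) - l2_trunc N x) <= e / 3.
  by rewrite l2_truncB; apply: rnorm_l2_trunc_le => [|i _]; exact: ltW.
apply: le_lt_trans (rdist_triangle (l2_trunc N x) _ _) _.
by apply: le_lt_trans (lerD hgx NP) _; lra.
Qed.

End L2.

Lemma iter_continuous (X : topologicalType) (f : X -> X) n :
  continuous f -> continuous (iter n f).
Proof.
move=> cf; elim: n => [|n ih] x; first exact: cvg_id.
by apply: (@continuous_comp _ _ _ (iter n f) f); [exact: ih|exact: cf].
Qed.

Section L2op.
Variables (R : realType) (k : scalar_kind) (H : normedModType (scalar_field R k)).
Variables (T : {linear H -> H}) (cT : continuous T).

Lemma iter_l2sum_op n (x : l2sum H) i : iter n (l2sum_op cT) x i = iter n T (x i).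
Proof. by elim: n => //= n ->. Qed.

Lemma iter_linear0 n : iter n T 0 = 0.
Proof. by elim: n => //= n ->; rewrite linear0. Qed.

Lemma iter_linearD n x y : iter n T (x + y) = iter n T x + iter n T y.
Proof. by elim: n => //= n ->; rewrite linearD. Qed.

Lemma iter_l2_trunc n N u :
  iter n (l2sum_op cT) (l2_trunc N u) = l2_trunc N (fun i => iter n T (u i)).
Proof.
apply: val_inj; apply/funext => i; rewrite /= iter_l2sum_op /=.
by case: ifP => //; rewrite iter_linear0.
Qed.

(** A bound for [T] applies in each coordinate, so the direct sum satisfies the same bound. *)
Lemma l2sum_op_continuous : continuous (l2sum_op cT).
Proof.
have [C C0 TC] : exists2 C : R, 0 < C & forall x, rnorm (T x) <= C * rnorm x.
  have /linear_boundedP := (linear_bounded_continuous T).2 cT.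
  move=> /pinfty_ex_gt0[M M0 TM]; exists (real_part M); first exact: real_part_gt0.
  move=> x; rewrite -(ler_of_real k) of_realM !rnormE (real_partK (ltW M0)).
  exact: TM.
apply/continuous_rnormP => x e e0; exists (e / C); first exact: divr_gt0.
move=> y; rewrite ltr_pdivlMr// mulrC; apply: le_lt_trans.
apply/l2_rnorm_leP => [|n]; first by rewrite mulr_ge0 ?rnorm_ge0// ltW.
rewrite exprMn (le_trans _ (ler_wpM2l _ (l2_rnorm_le (y - x) n))) ?sqr_ge0//.
rewrite mulr_sumr; apply: ler_sum => i _; rewrite -exprMn lerXn2r ?nnegrE ?rnorm_ge0//.
  by rewrite mulr_ge0 ?rnorm_ge0// ltW.
have -> : (l2sum_op cT y - l2sum_op cT x) i = T ((y - x) i).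
  by rewrite [RHS]linearB.
exact: TC.
Qed.

End L2op.

(** * Dynamics of T and of its direct sum *)

Lemma leq_homo_ltn (m : nat -> nat) i : {homo m : i j / (i < j)%N} -> (i <= m i)%N.
Proof.
by move=> mh; elim: i => // i ih; rewrite (leq_ltn_trans ih)// mh.
Qed.

Section Hypercyclic.
Variables (R : realType) (k : scalar_kind) (H : normedModType (scalar_field R k)).
Hypothesis nzH : exists x : H, x != 0.

Lemma ex_small (e : R) : 0 < e -> exists2 w : H, 0 < rnorm w & rnorm w < e.
Proof.
move=> e0; have [x x0] := nzH; have rx := rnorm_gt0 x0.
have c0 : 0 < e / 2 / rnorm x by rewrite !divr_gt0.
suff wE : rnorm (of_real k (e / 2 / rnorm x) *: x) = e / 2.
  by exists (of_real k (e / 2 / rnorm x) *: x); rewrite wE; lra.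
rewrite rnormZ ger0_norm; last by rewrite -(of_real0 R k) ler_of_real ltW.
by rewrite of_realK mulfVK// gt_eqF.
Qed.

Lemma open_nonzero (A : set H) : open A -> A !=set0 -> exists2 x, A x & x != 0.
Proof.
move=> /open_rnormP oA [x Ax]; have [x0|x0] := eqVneq x 0; last by exists x.
have [e e0 eA] := oA _ Ax; have [w w0 we] := ex_small e0.
exists w; first by apply: eA; rewrite x0 subr0.
by apply: contraTneq w0 => ->; rewrite rnorm0 ltxx.
Qed.

(** A nonzero normed space has no isolated points, so a ball can be shrunk or moved off the points
    one after another. It is used to stay away from an initial piece of an orbit. *)
Lemma open_avoid (A : set H) (s : seq H) : open A -> A !=set0 ->
  exists x (e : R), [/\ 0 < e, rball x e `<=` A &
    forall p, p \in s -> ~ rball x e p].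
Proof.
move=> /open_rnormP oA [x0 Ax0]; elim: s => [|q s [x [e [e0 eA es]]]].
  by have [e e0 eA] := oA _ Ax0; exists x0, e; split.
have [qx|qx] := eqVneq q x.
  have [w w0 we] := ex_small (divr_gt0 e0 (ltr0n _ 2)).
  (* The old centre [q = x] lies exactly on the boundary of the new open ball. *)
  exists (x + w), (rnorm w); split=> // y yw.
    apply: eA; apply: (rdist_lt (y := x + w) yw (b := e / 2)); last by lra.
    by rewrite addrC addKr.
  move: yw; rewrite in_cons => /orP[/eqP ->|/es ys].
    by rewrite qx /rball /= opprD addNKr rnormN ltxx.
  move=> yxw; apply: ys; apply: (rdist_lt (y := x + w) yxw (b := e / 2)); last by lra.
  by rewrite addrC addKr.
exists x, (Num.min e (rnorm (q - x))); split.
- by rewrite lt_min e0 rnorm_gt0// subr_eq0.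
- by move=> y; rewrite /rball /= lt_min => /andP[/eA].
- move=> y; rewrite in_cons /rball /= lt_min => /orP[/eqP ->|/es ys].
    by rewrite ltxx andbF.
  by move=> /andP[/ys].
Qed.

Section LinearIter.
Variables (T : {linear H -> H}) (cT : continuous T).

(** Used contrapositively: a small vector with a large image under T^n forces [n] beyond [N]. *)
Lemma iter_small N (e : R) : 0 < e -> exists2 d : R, 0 < d &
  forall w, rnorm w < d -> forall i, (i <= N)%N -> rnorm (iter i T w) < e.
Proof.
move=> e0; elim: N => [|N [d d0 dN]].
  by exists e => // w we i; rewrite leqn0 => /eqP ->.
have /continuous_rnormP cN := iter_continuous (n := N.+1) cT.
have [d' d'0 d'N] := cN 0 _ e0; exists (Num.min d d'); first by rewrite lt_min d0.
move=> w; rewrite lt_min => /andP[wd wd'] i; rewrite leq_eqVlt => /orP[/eqP ->|].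
  by have := d'N w; rewrite iter_linear0 !subr0; exact.
by rewrite ltnS; exact: dN.
Qed.

Definition three_open_sets := forall U V W : set H,
  open U -> U !=set0 -> open V -> V !=set0 -> nbhs 0 W ->
  exists n : nat, [/\ (0 < n)%N,
    (iter n T @` U) `&` W !=set0 & (iter n T @` W) `&` V !=set0].

(** The criterion does not ask (n_k) to increase. If the exponents were eventually bounded, S_(n_k)
    z -> 0 would force T^(n_k) S_(n_k) z -> 0, which is absurd for a nonzero [z] in [Z]. *)
Lemma criterion_unbounded (Z : set H) (n : nat -> nat) (S : nat -> H -> H) :
  dense Z -> (forall z, Z z ->
    S (n k) z @[k --> \oo] --> (0 : H) /\
    iter (n k) T (S (n k) z) @[k --> \oo] --> z) ->
  forall N M, exists i, (N < i)%N /\ (M < n i)%N.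
Proof.
move=> dZ SZ N M; apply: contrapT => nU.
have [z [z0 Zz]] : [set x : H | x != 0] `&` Z !=set0.
  have [x x0] := nzH.
  apply: dZ; first by exists x.
  rewrite (_ : [set x | _] = ~` [set 0]); last by apply/seteqP; split=> y /= /eqP.
  apply: closed_openC; apply: accessible_closed_set1.
  apply: hausdorff_accessible; exact: norm_hausdorff.
have [/cvg_rnormP S0 /cvg_rnormP TSz] := SZ z Zz.
have e0 : 0 < rnorm z / 2 by rewrite divr_gt0// rnorm_gt0.
have [d d0 dM] := iter_small M e0.
have [N1 N1P] := S0 _ d0; have [N2 N2P] := TSz _ e0.
pose i := maxn N.+1 (maxn N1 N2).
have := N2P i (leq_trans (leq_maxr _ _) (leq_maxr _ _)).
have niM : (n i <= M)%N.
  by rewrite leqNgt; apply/negP => h; apply: nU; exists i; rewrite leq_maxl.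
have Si : rnorm (S (n i) z) < d.
  by rewrite -[S _ _]subr0 N1P// (leq_trans (leq_maxl _ _) (leq_maxr _ _)).
have := dM _ Si _ niM.
rewrite rdistC; have := rdist_triangle (iter (n i) T (S (n i) z)) z 0.
by rewrite !subr0; lra.
Qed.

Lemma criterion_hereditary (h : nat -> H) : dense (range h) ->
  sequentially_complete H -> hypercyclicity_criterion T ->
  exists n : nat -> nat, [/\ forall i, (0 < n i)%N,
    {homo n : i j / (i < j)%N} & hereditarily_hypercyclic T n].
Proof.
move=> dh cH [Y [Z [n [dY dZ n0 Y0 [S SZ]]]]].
have /choice[g gP] i : exists j, (i < j)%N /\ (n i < n j)%N.
  exact: criterion_unbounded dZ SZ _ _.
(* Each application of [g] increases both the index and the exponent. *)
pose phi i := iter i g 0%N.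
have phiS : {homo phi : i j / (i < j)%N}.
  by apply: homo_ltn => [? ? ?|i]; [exact: ltn_trans|have [] := gP (phi i)].
exists (n \o phi); split=> [i|| m mh]; first exact: n0.
  by apply: homo_ltn => [? ? ?|i]; [exact: ltn_trans|have [] := gP (phi i)].
apply: (transitive_hypercyclic_seq cH dh) => [i|]; first exact: iter_continuous.
move=> A B oA A0 oB B0.
have [y [Ay Yy]] := dY _ A0 oA; have [z [Bz Zz]] := dZ _ B0 oB.
have /open_rnormP/(_ _ Ay)[e e0 eA] := oA.
have /open_rnormP/(_ _ Bz)[e' e'0 e'B] := oB.
have [/cvg_rnormP S0 /cvg_rnormP TSz] := SZ z Zz.
have /cvg_rnormP Ty0 := Y0 y Yy.
have [N1 N1P] := S0 _ e0.
have e'20 : 0 < e' / 2 by rewrite divr_gt0.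
have [N2 N2P] := TSz _ e'20; have [N3 N3P] := Ty0 _ e'20.
pose i := maxn N1 (maxn N2 N3); pose j := phi (m i).
have ij : (i <= j)%N := leq_trans (leq_homo_ltn i mh) (leq_homo_ltn _ phiS).
(* The point is near [y] since S_(n_j) z is small; its image is near [z] since T^(n_j) y is small
   and T^(n_j) S_(n_j) z is near [z]. *)
exists i, (y + S (n j) z); split.
  apply: eA; rewrite addrAC subrr add0r -[S _ _]subr0; apply: N1P.
  exact: leq_trans (leq_maxl _ _) ij.
apply: e'B; rewrite /= iter_linearD -addrA.
apply: le_lt_trans (ler_rnormD _ _) _; rewrite [ltRHS]splitr ltrD//.
  rewrite -[iter _ _ _]subr0; apply: N3P.
  by rewrite (leq_trans _ ij)// (leq_trans (leq_maxr _ _) (leq_maxr _ _)).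
apply: N2P; rewrite (leq_trans _ ij)//.
by rewrite (leq_trans (leq_maxl _ _) (leq_maxr _ _)).
Qed.

(* Every power of T has dense range and commutes with T, so T^p x is again
   hypercyclic along any subsequence along which x is. *)
Lemma hereditary_mixing (n : nat -> nat) (U V : set H) :
  (forall i, (0 < n i)%N) -> hereditarily_hypercyclic T n ->
  open U -> U !=set0 -> open V -> V !=set0 ->
  exists N, forall i, (N <= i)%N -> exists x, U x /\ V (iter (n i) T x).
Proof.
move=> n0 hT oU U0 oV V0; apply: contrapT => nN.
have /choice[g gP] N : exists i, (N <= i)%N /\
    forall x, U x -> ~ V (iter (n i) T x).
  apply: contrapT => ng; apply: nN; exists N => i Ni.
  by apply: contrapT => nx; apply: ng; exists i; split=> // x Ux Vx; apply: nx;
    exists x.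
(* Here [m i.+1 = g (m i).+1], so the bad indices form a strictly increasing sequence, along which
   [T] is still hypercyclic. *)
pose m i := g (iter i (S \o g) 0%N).
have mh : {homo m : i j / (i < j)%N}.
  apply: homo_ltn => [? ? ?|i]; first exact: ltn_trans.
  by rewrite {2}/m iterS /=; have [] := gP (g (iter i (S \o g) 0%N)).+1.
have [x dx] := hT m mh.
(* Since each exponent is positive, a dense set of vectors T^(n_(m i)) x lies in the range of
   [T]. *)
have dense_range_iter p (B : set H) : open B -> B !=set0 -> (iter p T @^-1` B) !=set0.
  elim: p B => [//|p ih] B oB B0.
  have oTB : open (T @^-1` B) by apply: open_comp oB => y _; exact: cT.
  have [|y Ty] := ih _ oTB; last by exists y.
  have [_ [/[swap] -[i _ <-] By]] := dx B B0 oB.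
  by exists (iter (n (m i)).-1 T x); rewrite /= -iterS prednK.
have [_ [/[swap] -[i _ <-] Uy]] := dx U U0 oU.
set p := n (m i) in Uy.
have oVp : open (iter p T @^-1` V).
  by apply: open_comp oV => y _; exact: iter_continuous.
(* Now T^p x lies in [U] and T^(n_(m j)) T^p x lies in [V], against the choice of the bad index
   [m j]. *)
have [_ [/[swap] -[j _ <-] Vy]] := dx _ (dense_range_iter p V oV V0) oVp.
have [_ /(_ _ Uy)] := gP (iter j (S \o g) 0%N); apply.
by move: Vy; rewrite /= -!iterD addnC.
Qed.

Lemma hereditary_l2sum_hypercyclic (n : nat -> nat) (h : nat -> H) :
  dense (range h) -> sequentially_complete H ->
  (forall i, (0 < n i)%N) -> hereditarily_hypercyclic T n ->
  hypercyclic (l2sum_op cT).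
Proof.
move=> dh cH n0 hT.
apply: (transitive_hypercyclic_seq (l2sum_sequentially_complete cH)
  (l2sum_separable dh)).
  by move=> m; apply: iter_continuous; exact: l2sum_op_continuous.
move=> A B /open_rnormP oA [a Aa] /open_rnormP oB [b Bb].
have [e e0 eA] := oA _ Aa; have [e' e'0 e'B] := oB _ Bb.
(* Truncation and coordinate errors take at most a third each; the last third makes the inequality
   strict. *)
have e20 : 0 < e / 3 by rewrite divr_gt0.
have e'20 : 0 < e' / 3 by rewrite divr_gt0.
have [N1 N1P] := l2_trunc_cvg a e20; have [N2 N2P] := l2_trunc_cvg b e'20.
pose N := maxn N1 N2.
have {}N1P := N1P N (leq_maxl _ _); have {}N2P := N2P N (leq_maxr _ _).
have d0 : 0 < e / 3 / N.+1%:R by rewrite divr_gt0 ?ltr0n.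
have d'0 : 0 < e' / 3 / N.+1%:R by rewrite divr_gt0 ?ltr0n.
(* Mixing holds from some index on in each coordinate, hence one exponent serves all [N] of them. *)
have [M MP] := @eventually_forall_ltn (fun i j => exists x,
    rball (a i) (e / 3 / N.+1%:R) x /\
    rball (b i) (e' / 3 / N.+1%:R) (iter (n j) T x))
  (fun i => hereditary_mixing n0 hT (rball_open _ _) (ex_intro _ _ (rball_center _ d0))
              (rball_open _ _) (ex_intro _ _ (rball_center _ d'0))) N.
have /choice[x xP] i : exists y, (i < N)%N -> rball (a i) (e / 3 / N.+1%:R) y /\
    rball (b i) (e' / 3 / N.+1%:R) (iter (n M) T y).
  by case: (boolP (i < N)%N) => [/(MP M (leqnn M))[y yP]|_]; [exists y|exists 0].
exists (n M), (l2_trunc N x); split.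
  apply: eA; apply: le_lt_trans (rdist_triangle (l2_trunc N a) _ _) _.
  apply: le_lt_trans (lerD _ N1P) _; last first.
    by instantiate (1 := e / 3); lra.
  rewrite l2_truncB; apply: rnorm_l2_trunc_le => [|i iN]; first exact: ltW.
  by apply: ltW; case: (xP i iN).
apply: e'B; rewrite iter_l2_trunc.
apply: le_lt_trans (rdist_triangle (l2_trunc N b) _ _) _.
apply: le_lt_trans (lerD _ N2P) _; last first.
  by instantiate (1 := e' / 3); lra.
rewrite l2_truncB; apply: rnorm_l2_trunc_le => [|i iN]; first exact: ltW.
by apply: ltW; case: (xP i iN).
Qed.

(** If two coordinates of the orbit are near (u, 0) at time [j] and near (0, v) at a later time [m],
    then [m - j] carries [U] into [W] by the first coordinate and [W] into [V] by the second. *)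
Lemma l2sum_hypercyclic_three_open_sets :
  hypercyclic (l2sum_op cT) -> three_open_sets.
Proof.
case=> x /dense_rnormP dx U V W oU [u Uu] oV V0 /nbhs_rnormP[r r0 rW].
have hit (a b : H) (e : R) : 0 < e -> exists m,
    rnorm (iter m T (x 0%N) - a) < e /\ rnorm (iter m T (x 1%N) - b) < e.
  move=> e0; pose y := l2_trunc 2 (fun i => if i == 0%N then a else b).
  have [_ [m _ <-] my] := dx y e e0; exists m; rewrite -!(iter_l2sum_op cT).
  split; apply: le_lt_trans my.
    exact: (rnorm_l2_val (iter m (l2sum_op cT) x - y) 0%N).
  exact: (rnorm_l2_val (iter m (l2sum_op cT) x - y) 1%N).
have /open_rnormP/(_ _ Uu)[e e0 eU] := oU.
have [j [ju jw]] : exists m, rnorm (iter m T (x 0%N) - u) < e /\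
    rnorm (iter m T (x 1%N) - 0) < r.
  have [|m [mu mw]] := hit u 0 (Num.min e r); first by rewrite lt_min e0.
  by exists m; move: mu mw; rewrite !lt_min => /andP[-> _] /andP[_ ->].
(* Avoiding the orbit of the second coordinate up to time [j] ensures [j < m]. *)
have [v [e' [e'0 e'V avoid]]] :=
  open_avoid (mkseq (fun i => iter i T (x 1%N)) j.+1) oV V0.
have [m [mw mv]] : exists m, rnorm (iter m T (x 0%N) - 0) < r /\
    rnorm (iter m T (x 1%N) - v) < e'.
  have [|m [mu mv]] := hit 0 v (Num.min r e'); first by rewrite lt_min r0.
  by exists m; move: mu mv; rewrite !lt_min => /andP[-> _] /andP[_ ->].
have jm : (j < m)%N.
  rewrite ltnNge; apply/negP => mj; apply: avoid mv.
  by apply/mapP; exists m => //; rewrite mem_iota ltnS.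
exists (m - j)%N; split; first by rewrite subn_gt0.
  exists (iter m T (x 0%N)); split; last by apply: rW; rewrite subr0 in mw *.
  by exists (iter j T (x 0%N)); [exact: eU|rewrite -iterD subnK// ltnW].
exists (iter m T (x 1%N)); split; last exact: e'V.
by exists (iter j T (x 1%N)); [exact: rW|rewrite -iterD subnK// ltnW].
Qed.

(** Add a point of [U] sent near 0 to a point near 0 sent into [V]. *)
Lemma three_open_sets_transitive (U V : set H) : three_open_sets ->
  open U -> U !=set0 -> open V -> V !=set0 ->
  exists n x, U x /\ V (iter n T x).
Proof.
move=> T3 /open_rnormP oU [u Uu] /open_rnormP oV [v Vv].
have [e e0 eU] := oU _ Uu; have [e' e'0 e'V] := oV _ Vv.
pose r := Num.min (e / 2) (e' / 2).
have r0 : 0 < r by rewrite lt_min !divr_gt0.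
have re : r + r <= e by have : r <= e / 2 by [rewrite ge_min lexx|]; lra.
have re' : r + r <= e' by have : r <= e' / 2 by [rewrite ge_min lexx orbT|]; lra.
have [|||||n [_]] := T3 (rball u r) (rball v r) (rball 0 r).
- exact: rball_open.
- by exists u; exact: rball_center.
- exact: rball_open.
- by exists v; exact: rball_center.
- by apply/nbhs_rnormP; exists r.
move=> [_ [[a ua <-] wa]] [_ [[w w0 <-] vw]]; exists n, (a + w); split.
  apply: eU; rewrite addrAC; apply: le_lt_trans (ler_rnormD _ _) _.
  by rewrite /rball /= subr0 in ua w0; apply: lt_le_trans (ltrD ua w0) re.
apply: e'V; rewrite iter_linearD -addrA; apply: le_lt_trans (ler_rnormD _ _) _.
by rewrite /rball /= subr0 in wa vw; apply: lt_le_trans (ltrD wa vw) re'.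
Qed.

(* Membership of x in this set for every j yields the sequences n_k and u_k with
   T^(n_k) x -> 0, u_k -> 0 and T^(n_k) u_k -> x. *)
Definition approx_return (j : nat) : set H :=
  \bigcup_(p in [set p : nat * H | (j < p.1)%N /\ rnorm p.2 < j.+1%:R^-1])
    (iter p.1 T @^-1` rball 0 j.+1%:R^-1 `&` rball (iter p.1 T p.2) j.+1%:R^-1).

Lemma approx_return_open j : open (approx_return j).
Proof.
apply: bigcup_open => p _; apply: openI; last exact: rball_open.
by apply: open_comp (rball_open _ _) => y _; exact: iter_continuous.
Qed.

(** Apply the condition with both open sets a small ball about a nonzero [p]: some [x] near [p] is
    sent near 0, and some small [w] is sent near [p], hence near [x]. *)
Lemma approx_return_dense j : three_open_sets -> dense (approx_return j).
Proof.
move=> T3 A A0 oA; have [p Ap p0] := open_nonzero oA A0.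
have /open_rnormP/(_ _ Ap)[e e0 eA] := oA.
have c0 : 0 < j.+1%:R^-1 :> R by rewrite invr_gt0 ltr0n.
set c := j.+1%:R^-1 in c0.
have p20 : 0 < rnorm p / 2 by rewrite divr_gt0// rnorm_gt0.
(* These bounds keep [x] in [A], keep T^n w within [c] of [x], and keep T^n w away from 0, so that
   [n > j] by [iter_small]. *)
pose r := Num.min e (Num.min (c / 2) (rnorm p / 2)).
have r0 : 0 < r by rewrite !lt_min e0 p20 divr_gt0.
have [d d0 dj] := iter_small j p20.
pose d' := Num.min d c.
have d'0 : 0 < d' by rewrite lt_min d0.
have [|||||n [_]] := T3 (rball p r) (rball p r) (rball 0 d').
- exact: rball_open.
- by exists p; exact: rball_center.
- exact: rball_open.
- by exists p; exact: rball_center.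
- by apply/nbhs_rnormP; exists d'.
move=> [_ [[x px <-] wx]] [_ [[w w0 <-] pw]].
have {}w0 : rnorm w < d' by move: w0; rewrite /rball /= subr0.
have [re [rc rp]] : r <= e /\ r <= c / 2 /\ r <= rnorm p / 2.
  by rewrite /r !ge_min !lexx !orbT.
exists x; split; first by apply: eA; exact: lt_le_trans px re.
have [wd wc] : rnorm w < d /\ rnorm w < c by apply/andP; rewrite -lt_min.
exists (n, w) => /=; first split=> //.
  rewrite ltnNge; apply/negP => nj; have := dj _ wd _ nj.
  have := rdist_triangle (iter n T w) p 0; rewrite !subr0 (rdistC p).
  by rewrite /rball /= in pw; lra.
split; first by apply: lt_le_trans wx _; rewrite ge_min lexx orbT.
by move: pw; rewrite /rball /= rdistC => pw; apply: (rdist_lt px pw); rewrite -/c; lra.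
Qed.

Lemma three_open_sets_criterion (h : nat -> H) : dense (range h) ->
  sequentially_complete H -> three_open_sets -> hypercyclicity_criterion T.
Proof.
move=> dh cH T3.
(* The left summand gives a dense orbit, the right one the approximate returns. *)
pose F (i : (nat * nat) + nat) := match i with
  | inl p => \bigcup_m iter m T @^-1` rball (h p.1) p.2.+1%:R^-1
  | inr j => approx_return j end.
have dF : dense (\bigcap_i F i).
  apply: baire => // -[[i j]|j]; split=> /=.
  - by apply: hits_open (rball_open _ _) => m; exact: iter_continuous.
  - move=> A A0 oA; have [|m [x [Ax Tx]]] := three_open_sets_transitive T3 oA A0
      (rball_open (h i) j.+1%:R^-1).
      by exists (h i); apply: rball_center; rewrite invr_gt0 ltr0n.
    by exists x; split=> //; exists m.
  - exact: approx_return_open.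
  - exact: approx_return_dense.
have [x Fx] : exists x : H, forall i, F i x.
  have [||x [_ Fx]] := dF setT; [by exists 0|exact: openT|].
  by exists x => i; exact: Fx.
have dx : dense (range (fun m => iter m T x)).
  by apply: (dense_orbit (F := fun m => iter m T) dh) => i j; exact: (Fx (inl (i, j))).
have /choice[f fP] j : exists p : nat * H, [/\ (j < p.1)%N, rnorm p.2 < j.+1%:R^-1,
    rnorm (iter p.1 T x) < j.+1%:R^-1 & rnorm (iter p.1 T p.2 - x) < j.+1%:R^-1].
  have [p [jp pj] [/= Tx Tp]] := Fx (inr j); exists p; split=> //.
    by move: Tx; rewrite /rball /= subr0.
  by rewrite rdistC.
pose J i := iter i (fun j => (f j).1) 0%N.
have J_homo : {homo J : i j / (i < j)%N}.
  by apply: homo_ltn => [? ? ?|i]; [exact: ltn_trans|case: (fP (J i))].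
pose n i := J i.+1; pose u i := (f (J i)).2.
(* The maps S are indexed by the exponent and not by its position, so [u i] must be recoverable from
   [n i]. *)
have n_inj : injective n.
  move=> i j; case: (ltngtP i j) => // ij; have := J_homo i.+1 j.+1.
    by move=> + nij; rewrite -/(n i) nij ltnS ij ltnn => /(_ isT).
  have := J_homo j.+1 i.+1.
  by move=> + _ nij; rewrite -/(n i) nij ltnS ij ltnn => /(_ isT).
have /choice[w wP] m : exists y, forall i, m = n i -> y = u i.
  have [[i mi]|ni] := pselect (exists i, m = n i).
    by exists (u i) => j; rewrite mi => /n_inj ->.
  by exists 0 => i mi; case: ni; exists i.
have small (y : nat -> H) (l : H) :
    (forall i, rnorm (y i - l) < (J i).+1%:R^-1) -> y i @[i --> \oo] --> l.
  move=> yJ; apply/cvg_rnormP => e e0; have [N Ne] := ex_invn_lt e0; exists N => i Ni.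
  apply: lt_trans (yJ i) (le_lt_trans _ Ne).
  rewrite lef_pV2 ?posrE ?ltr0n// ler_nat ltnS (leq_trans Ni)//.
  exact: leq_homo_ltn.
have iter0 m : iter m T y @[y --> (0 : H)] --> (0 : H).
  by have := @iter_continuous H T m cT 0; rewrite /continuous_at iter_linear0.
(* Choosing one exponent for each orbit point makes S a function of the point; it need not be
   linear. *)
have /choice[o oP] z : exists m, range (fun m => iter m T x) z -> z = iter m T x.
  have [[m _ <-]|nz] := pselect (range (fun m => iter m T x) z); last by exists 0%N.
  by exists m.
exists (range (fun m => iter m T x)), (range (fun m => iter m T x)), n; split=> //.
- by move=> i; rewrite (leq_trans _ (leq_homo_ltn i.+1 J_homo)).
- move=> _ [m _ <-].
  rewrite (_ : (fun i => _) = fun i => iter m T (iter (n i) T x)); last first.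
    by apply/funext => i; rewrite -!iterD addnC.
  apply: cvg_comp (iter0 m); apply: small => i; rewrite subr0.
  by case: (fP (J i)).
exists (fun m z => iter (o z) T (w m)) => z zx.
have wn i : w (n i) = u i by exact: wP.
split.
  under eq_fun do rewrite wn.
  apply: cvg_comp (iter0 _); apply: small => i; rewrite subr0.
  by case: (fP (J i)).
rewrite (_ : (fun i => _) = fun i => iter (o z) T (iter (n i) T (u i))); last first.
  by apply/funext => i; rewrite wn -!iterD addnC.
rewrite [X in _ --> X](oP _ zx).
apply: (@continuous_cvg _ _ _ _ _ _ (iter (o z) T)); first exact: iter_continuous.
by apply: small => i; case: (fP (J i)).
Qed.

End LinearIter.
End Hypercyclic.

(** * Orthonormal bases and Hilbert-Schmidt operators *)

Section Hilbert.
Variables (R : realType) (k : scalar_kind) (H : normedModType (scalar_field R k)).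
Notation K := (scalar_field R k).
Variable dot : {dot H for conj_scalar k}.
Hypothesis normE : forall x : H, `|x| ^+ 2 = dot x x.

Definition scalar_abs (a : K) : R := real_part `|a|.

Lemma dotC x y : dot x y = conj_scalar k (dot y x).
Proof. by rewrite (hermitian_subproof x y) expr0 mul1r. Qed.

Lemma dotDl x y z : dot (x + y) z = dot x z + dot y z.
Proof. exact: linearDl. Qed.

Lemma dotBl x y z : dot (x - y) z = dot x z - dot y z.
Proof. exact: linearBl. Qed.

Lemma dotZl a x y : dot (a *: x) y = a * dot x y.
Proof. exact: linearZl_LR. Qed.

Lemma dotDr x y z : dot x (y + z) = dot x y + dot x z.
Proof. exact: linearDr. Qed.

Lemma dotZr a x y : dot x (a *: y) = conj_scalar k a * dot x y.
Proof. exact: linearZr_LR. Qed.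

Lemma dot_suml (s : seq H) (f : H -> H) y :
  dot (\sum_(v <- s) f v) y = \sum_(v <- s) dot (f v) y.
Proof. exact: linear_sumlz. Qed.

Lemma dot_sumr (s : seq H) (f : H -> H) y :
  dot y (\sum_(v <- s) f v) = \sum_(v <- s) dot y (f v).
Proof. exact: linear_sumr. Qed.

Lemma dot_eq0C x y : dot x y = 0 -> dot y x = 0.
Proof. by move=> xy; rewrite dotC xy conj_scalar_ge0. Qed.

Lemma dot_orthD x y : dot x y = 0 -> dot (x + y) (x + y) = dot x x + dot y y.
Proof. by move=> xy; rewrite dotDl !dotDr xy (dot_eq0C xy) addr0 add0r. Qed.

(** Uniqueness is required separately: the relation on members does not see repetitions, which
    [proj] would count twice. *)
Definition orthonormal_seq (s : seq H) :=
  uniq s /\ {in s &, forall u v, dot u v = (u == v)%:R}.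

Definition proj (s : seq H) x := \sum_(v <- s) dot x v *: v.

Lemma projB s x y : proj s (x - y) = proj s x - proj s y.
Proof.
rewrite /proj -sumrB; apply: eq_bigr => v _.
by rewrite dotBl scalerBl.
Qed.

Lemma proj_rcons s v x : proj (rcons s v) x = proj s x + dot x v *: v.
Proof. by rewrite /proj -cats1 big_cat big_seq1. Qed.

Lemma dot_proj s x v : orthonormal_seq s -> v \in s -> dot (proj s x) v = dot x v.
Proof.
move=> [us os] vs; rewrite /proj dot_suml (bigD1_seq v)//= dotZl (os v v)// eqxx mulr1.
rewrite big_seq_cond big1 ?addr0// => u /andP[us' uv].
by rewrite dotZl (os u v)// (negPf uv) mulr0.
Qed.

Lemma dot_projr_eq0 s x y : {in s, forall v, dot x v = 0} -> dot x (proj s y) = 0.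
Proof.
move=> xs; rewrite /proj dot_sumr big_seq big1// => v vs.
by rewrite dotZr xs// mulr0.
Qed.

(** The residual is orthogonal to the projection. Both the contraction estimate and Bessel's
    inequality come from this identity. *)
Lemma pythagoras s x : orthonormal_seq s ->
  `|x| ^+ 2 = `|x - proj s x| ^+ 2 + \sum_(v <- s) `|dot x v| ^+ 2.
Proof.
move=> os; have orth : dot (x - proj s x) (proj s x) = 0.
  by apply: dot_projr_eq0 => v vs; rewrite dotBl dot_proj// subrr.
have -> : \sum_(v <- s) `|dot x v| ^+ 2 = dot (proj s x) (proj s x).
  rewrite {2}/proj dot_sumr; apply: eq_big_seq => v vs.
  by rewrite dotZr dot_proj// mulrC mul_conj_scalar.
by rewrite !normE -(dot_orthD orth) subrK.
Qed.

Lemma rnorm_proj_le s x : orthonormal_seq s -> rnorm (x - proj s x) <= rnorm x.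
Proof.
move=> os; rewrite -(ler_of_real k) !rnormE.
rewrite -(@ler_pXn2r _ 2) ?nnegrE// (pythagoras x os) lerDl.
by apply: sumr_ge0 => v _; exact: exprn_ge0.
Qed.

Lemma bessel s x : orthonormal_seq s ->
  \sum_(v <- s) scalar_abs (dot x v) ^+ 2 <= rnorm x ^+ 2.
Proof.
move=> os; rewrite -(ler_of_real k).
rewrite (big_morph (of_real k) (@of_realD R k) (of_real0 R k)).
rewrite {1}expr2 of_realM !rnormE -expr2 (pythagoras x os).
under eq_bigr do rewrite expr2 of_realM /scalar_abs real_partK// -expr2.
by rewrite lerDr exprn_ge0.
Qed.

(** * Gram-Schmidt and the existence of an orthonormal basis *)

Section GramSchmidt.
Variables (h : nat -> H).
Hypotheses (dh : dense (range h)) (infH : infinite_dimensional H).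

(** Otherwise the contraction x - [proj s x] vanishes on a dense set, hence everywhere, and the
    finite list [s] spans [H]. *)
Lemma ex_proj_neq s : orthonormal_seq s -> exists m, proj s (h m) != h m.
Proof.
move=> os; apply: contrapT => nex.
have projh m : proj s (h m) = h m.
  by apply/eqP; apply: contrapT => /negP hm; apply: nex; exists m.
have [x xs] := infH s; apply: (xs (fun i => dot x (nth 0 s i))).
rewrite -(big_mkord xpredT (fun i => dot x (nth 0 s i) *: nth 0 s i)).
rewrite -(big_nth 0 xpredT (fun v => dot x v *: v)) -/(proj s x).
apply/eqP; rewrite -subr_eq0; apply/eqP; apply: rnorm0_eq0.
apply/eqP; rewrite eq_le rnorm_ge0 andbT; apply/ler_addgt0Pr => e e0.
have /dense_rnormP/(_ x e e0)[_ [m _ <-] hx] := dh.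
rewrite add0r rdistC -[proj s x](subrK (h m)) -addrA -opprB.
rewrite -{1}(projh m) -projB.
by rewrite [X in rnorm X]addrC (le_trans (rnorm_proj_le _ os))// ltW.
Qed.

(** The new vector is the normalised residual of the first h_q outside the span. Dependent vectors
    are thus skipped, and each step still extends the initial segment of [h] known to be in the
    span. *)
Lemma gram_schmidt_step s : orthonormal_seq s -> exists v,
  orthonormal_seq (rcons s v) /\
  forall p, (forall m, (m < p)%N -> proj s (h m) = h m) ->
    forall m, (m <= p)%N -> proj (rcons s v) (h m) = h m.
Proof.
move=> os; have exm := ex_proj_neq os.
case: (ex_minnP exm) => q qs qmin.
pose w := h q - proj s (h q).
have w0 : w != 0 by rewrite subr_eq0 eq_sym.
pose a := `|w|^-1; have a0 : 0 <= a by rewrite invr_ge0.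
have aw : a * `|w| = 1 by rewrite mulVf// normr_eq0.
have ws v : v \in s -> dot w v = 0.
  by move=> vs; rewrite dotBl dot_proj// subrr.
have wv : dot w w = `|w| ^+ 2 by rewrite normE.
have awaw : dot (a *: w) (a *: w) = 1.
  by rewrite dotZl dotZr conj_scalar_ge0// wv expr2 [X in _ * X]mulrA aw mul1r.
have hqv : dot (h q) (a *: w) = `|w|.
  rewrite -[h q](subrK (proj s (h q))) -/w dotDl [X in _ + X]dot_eq0C ?addr0.
    by rewrite dotZr conj_scalar_ge0// wv expr2 mulrA aw mul1r.
  apply: dot_projr_eq0 => v vs.
  by rewrite dotZl ws// mulr0.
have aws v : v \in s -> dot (a *: w) v = 0 by move=> vs; rewrite dotZl ws// mulr0.
exists (a *: w); split.
  have nws : a *: w \notin s.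
    by apply/negP => /aws; rewrite awaw => /eqP; rewrite oner_eq0.
  split; first by rewrite rcons_uniq nws os.1.
  move=> u v; rewrite !mem_rcons !in_cons => /orP[/eqP ->|us] /orP[/eqP ->|vs].
  - by rewrite eqxx awaw.
  - by rewrite aws//; case: eqP => // awv; rewrite awv vs in nws.
  - rewrite dot_eq0C ?aws//; case: eqP => // awv; by rewrite -awv us in nws.
  - exact: os.2.
move=> p ps m; rewrite proj_rcons.
(* A vector already in the span is orthogonal to the new one and stays fixed. *)
have proj_s : proj s (h m) = h m -> proj s (h m) + dot (h m) (a *: w) *: (a *: w) = h m.
  move=> hm; rewrite -{2}hm [X in X *: _]dot_eq0C ?scale0r ?addr0//.
  exact: dot_projr_eq0.
rewrite leq_eqVlt => /orP[/eqP mp|/ps]; last exact: proj_s.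
have [/proj_s//|hm] := eqVneq (proj s (h m)) (h m).
have {mp ps}mq : m = q.
  apply/eqP; rewrite eqn_leq qmin// andbT mp leqNgt; apply/negP => /ps qq.
  by rewrite qq eqxx in qs.
by rewrite mq hqv scalerA mulrC aw scale1r addrC subrK.
Qed.

Lemma ex_orthonormal_basis : exists e : nat -> H, orthonormal_basis dot e.
Proof.
have /choice[g gP] s : exists v, orthonormal_seq s ->
    orthonormal_seq (rcons s v) /\
    forall p, (forall m, (m < p)%N -> proj s (h m) = h m) ->
      forall m, (m <= p)%N -> proj (rcons s v) (h m) = h m.
  have [/gram_schmidt_step[v vP]|ns] := pselect (orthonormal_seq s).
    by exists v.
  by exists 0.
pose s n := iter n (fun s => rcons s (g s)) [::].
pose e n := g (s n).
have sE n : s n = mkseq e n by elim: n => // n ih; rewrite mkseqS -ih.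
have [os ps] : (forall n, orthonormal_seq (s n)) /\
    (forall n m, (m < n)%N -> proj (s n) (h m) = h m).
  have both n : orthonormal_seq (s n) /\
      forall m, (m < n)%N -> proj (s n) (h m) = h m.
    elim: n => [|n [osn psn]]; first by [].
    by have [oS pS] := gP (s n) osn; split=> // m; rewrite ltnS; exact: pS.
  by split=> n; case: (both n).
exists e; split=> [i j|].
  have im : (i < (maxn i j).+1)%N by rewrite ltnS leq_maxl.
  have jm : (j < (maxn i j).+1)%N by rewrite ltnS leq_maxr.
  have [us] := os (maxn i j).+1; rewrite sE in us * => ->.
  - by rewrite -{1}(nth_mkseq 0 e im) -{1}(nth_mkseq 0 e jm) nth_uniq ?size_mkseq.
  - by apply/mapP; exists i => //; rewrite mem_iota.
  - by apply/mapP; exists j => //; rewrite mem_iota.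
apply/dense_rnormP => x d d0.
have /dense_rnormP/(_ x d d0)[_ [m _ <-] hx] := dh.
exists (h m) => //; exists m.+1, (fun i => dot (h m) (e i)).
rewrite -{1}(ps m.+1 m (ltnSn m)) /proj sE big_map.
by rewrite -[iota _ _]/(index_iota 0 m.+1) big_mkord.
Qed.

End GramSchmidt.

Lemma rnormZ_abs (a : K) (x : H) : rnorm (a *: x) = scalar_abs a * rnorm x.
Proof. exact: rnormZ. Qed.

Lemma bessel_onb (e : onb dot) n x :
  \sum_(i < n) scalar_abs (dot x (e i)) ^+ 2 <= rnorm x ^+ 2.
Proof.
have [oe _] := onbP e.
have e_inj : injective e.
  move=> i j eij; apply/eqP; have := oe i j; rewrite eij oe eqxx.
  by case: eqP => // _ /eqP; rewrite oner_eq0.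
have := @bessel (mkseq e n) x; rewrite big_map
  -[n in iota _ n]subn0 -/(index_iota 0 n) big_mkord.
apply; split; first exact: mkseq_uniq.
by move=> _ _ /mapP[i _ ->] /mapP[j _ ->]; rewrite oe (inj_eq e_inj).
Qed.

(** * Hilbert-Schmidt operators with prescribed values on a basis *)

Section HilbertSchmidtExtension.
Hypothesis cH : sequentially_complete H.

Lemma abs_series_cvg (u : nat -> H) (M : R) :
  (forall n, \sum_(i < n) rnorm (u i) <= M) ->
  exists l : H, \sum_(i < n) u i @[n --> \oo] --> l.
Proof.
move=> uM; apply: cH => e e0.
pose s n := \sum_(0 <= i < n) rnorm (u i).
have supS : has_sup (range s).
  by split; [exists (s 0%N), 0%N|exists M => _ [n _ <-]; rewrite /s big_mkord].
have [_ [N _ <-] Ne] := sup_adherent e0 supS.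
exists N => n Nn.
have -> : \sum_(i < n) u i - \sum_(i < N) u i = \sum_(N <= i < n) u i.
  rewrite -!(big_mkord xpredT u) (big_cat_nat (leq0n _) Nn)//=.
  by rewrite addrAC subrr add0r.
apply: le_lt_trans (rnorm_sum _ _ _) _.
have -> : \sum_(N <= i < n) rnorm (u i) = s n - s N.
  by rewrite /s (big_cat_nat (leq0n _) Nn)//= addrAC subrr add0r.
have := ub_le_sup supS.2 (imageT s n).
by lra.
Qed.

Lemma cvg_rnorm_le (u : nat -> H) (l : H) (M : R) :
  u n @[n --> \oo] --> l -> (forall n, rnorm (u n) <= M) -> rnorm l <= M.
Proof.
move=> /cvg_rnormP ul uM; apply/ler_addgt0Pr => d d0.
have [N /(_ _ (leqnn N)) Nd] := ul _ d0.
rewrite -[l](subKr (u N)) (le_trans (ler_rnormD _ _))// rnormN.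
by rewrite lerD ?uM// ltW.
Qed.

(** The operator is A h = sum_i <h,e_i> x_i, absolutely convergent by Bessel's inequality. *)
Lemma ex_hs (e : onb dot) (x : l2sum H) :
  exists A : hs e, forall i, A (e i) = x i.
Proof.
pose t (h : H) i := dot h (e i) *: x i.
pose M (h : H) := (rnorm h ^+ 2 + rnorm x ^+ 2) / 2.
(* AM-GM: 2 |<h,e_i>| |x_i| <= |<h,e_i>|^2 + |x_i|^2 *)
have tM h n : \sum_(i < n) rnorm (t h i) <= M h.
  apply: (@le_trans _ _ (\sum_(i < n)
      (scalar_abs (dot h (e i)) ^+ 2 + rnorm (x i) ^+ 2) / 2)).
    apply: ler_sum => i _; rewrite rnormZ_abs.
    set a := scalar_abs _; set b := rnorm _.
    by have := sqr_ge0 (a - b); rewrite sqrrB mulr2n; lra.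
  rewrite -mulr_suml ler_wpM2r ?invr_ge0// big_split lerD ?bessel_onb//.
  exact: l2_rnorm_le.
have /choice[A AP] h := abs_series_cvg (tM h).
have AM h : rnorm (A h) <= M h.
  by apply: cvg_rnorm_le (AP h) _ => n; rewrite (le_trans (rnorm_sum _ _ _)).
have cvg_eq (u : nat -> H) (l l' : H) :
    u n @[n --> \oo] --> l -> u n @[n --> \oo] --> l' -> l = l'.
  exact: (cvg_unique (@norm_hausdorff _ H)).
have lA : linear A.
  move=> a g h; apply: cvg_eq (AP _) _.
  rewrite (_ : (fun n => _) =
      (fun n => a *: \sum_(i < n) t g i + \sum_(i < n) t h i)); last first.
    apply/funext => n; rewrite scaler_sumr -big_split; apply: eq_bigr => i _.
    by rewrite /t dotDl dotZl scalerDl scalerA.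
  by apply: cvgD; [apply: cvgZl_tmp|]; exact: AP.
pose C := (1 + rnorm x ^+ 2) / 2.
have C0 : 0 < C by rewrite divr_gt0// ltr_wpDr ?sqr_ge0.
have AB g h : A (g - h) = A g - A h.
  by rewrite addrC -scaleN1r lA scaleN1r addrC.
have A0 : A 0 = 0 by rewrite -[in LHS](subrr (0 : H)) AB subrr.
(* The bound [M h] is not homogeneous; rescaling to the unit ball, where it is at most [C], makes it
   linear. *)
have AC h (d : R) : 0 < d -> rnorm h <= d -> rnorm (A h) <= d * C.
  move=> d0 hd; pose c : K := of_real k d.
  have c0 : c != 0.
    rewrite /c -(of_real0 R k).
    by rewrite (inj_eq (can_inj (@of_realK R k))) gt_eqF.
  have cd : scalar_abs c = d.
    rewrite /scalar_abs ger0_norm ?of_realK//.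
    by rewrite /c -(of_real0 R k) ler_of_real ltW.
  have hE : h = c *: (c^-1 *: h) by rewrite scalerA mulfV// scale1r.
  have g1 : rnorm (c^-1 *: h) <= 1.
    by rewrite -(ler_pM2l d0) -cd -rnormZ_abs -hE cd mulr1.
  rewrite {1}hE -[c *: _]addr0 lA A0 addr0 rnormZ_abs cd ler_pM2l//.
  apply: le_trans (AM _) _; rewrite ler_pM2r ?invr_gt0// lerD2r.
  by rewrite expr_le1 ?rnorm_ge0.
have cA : continuous A.
  apply/continuous_rnormP => h d d0; exists (d / (C + 1)).
    by rewrite divr_gt0// addr_gt0.
  move=> g /ltW gh; rewrite -AB; apply: le_lt_trans (AC _ _ _ gh) _.
    by rewrite divr_gt0// addr_gt0.
  by rewrite -mulrA gtr_pMr// mulrC ltr_pdivrMr ?mul1r ?ltrDl// addr_gt0.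
have Ae i : A (e i) = x i.
  apply: cvg_eq (AP _) _; apply/cvg_rnormP => d d0; exists i.+1 => n ni.
  rewrite (bigD1 (Ordinal ni))//= /t (onbP e).1 eqxx scale1r big1 ?addr0.
    by rewrite subrr rnorm0.
  move=> j ji; rewrite (onbP e).1 (_ : (i == j) = false) ?scale0r//.
  by apply/negbTE; apply: contra_neqN ji => /eqP ij; apply/val_inj.
have hsA : hilbert_schmidt e A.
  split=> //; rewrite (_ : A \o e = x); last exact/funext.
  exact: (valP x).
by exists (HS (asboolT hsA)).
Qed.

Variables (T : {linear H -> H}) (cT : continuous T).

Lemma iter_hs_lmul (e : onb dot) (A : hs e) n v :
  iter n (hs_lmul e cT) A v = iter n T (A v).
Proof. by elim: n => //= n ->. Qed.

Lemma hs_val_fin (e : onb dot) (A : hs e) : (sqsum (A \o e) < +oo)%E.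
Proof. by have [] := hsP A. Qed.

Definition l2_of_hs (e : onb dot) (A : hs e) : l2sum H := L2sum (hs_val_fin A).

(** Both sides are the [l2norm] of the same sequence, so the isometry holds by computation. *)
Lemma rnorm_hsB (e : onb dot) (A B : hs e) :
  rnorm (A - B) = rnorm (l2_of_hs A - l2_of_hs B).
Proof. by []. Qed.

Lemma iter_l2_of_hs (e : onb dot) (A : hs e) n :
  l2_of_hs (iter n (hs_lmul e cT) A) = iter n (l2sum_op cT) (l2_of_hs A).
Proof.
by apply: val_inj; apply/funext => i; rewrite /= iter_hs_lmul; exact/esym/iter_l2sum_op.
Qed.

Lemma ex_l2_of_hs (e : onb dot) (x : l2sum H) : exists A : hs e, l2_of_hs A = x.
Proof.
by have [A Ae] := ex_hs e x; exists A; apply: val_inj; apply/funext => i; exact: Ae.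
Qed.

(* A |-> (A e_i)_i is a bijective isometry conjugating L_T to the direct sum. *)
Lemma hs_lmul_hypercyclic (e : onb dot) :
  hypercyclic (hs_lmul e cT) <-> hypercyclic (l2sum_op cT).
Proof.
split=> [[A /dense_rnormP dA]|[x /dense_rnormP dx]].
  exists (l2_of_hs A); apply/dense_rnormP => y d d0.
  have [B By] := ex_l2_of_hs e y; have [_ [m _ <-] mB] := dA B d d0.
  exists (iter m (l2sum_op cT) (l2_of_hs A)); first by exists m.
  by rewrite -By -iter_l2_of_hs -rnorm_hsB.
have [A Ax] := ex_l2_of_hs e x; exists A; apply/dense_rnormP => B d d0.
have [_ [m _ <-] mB] := dx (l2_of_hs B) d d0.
exists (iter m (hs_lmul e cT) A); first by exists m.
by rewrite rnorm_hsB iter_l2_of_hs Ax.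
Qed.

End HilbertSchmidtExtension.
End Hilbert.

Lemma separable_sequence (X : topologicalType) (x0 : X) : separable X ->
  exists h : nat -> X, dense (range h).
Proof.
move=> [D /countable_injP[f f_inj] dD].
(* Numbers that encode no point of [D] are sent to [x0], which does not affect density. *)
have /choice[h hP] n : exists x, forall y, D y -> f y = n -> x = y.
  have [[x [Dx fx]]|nx] := pselect (exists x, D x /\ f x = n).
    by exists x => y Dy fy; apply: f_inj; rewrite ?inE// fx.
  by exists x0 => y Dy fy; case: nx; exists y.
exists h => A A0 oA; have [x [Ax Dx]] := dD A A0 oA.
by exists x; split=> //; exists (f x) => //; exact: hP.
Qed.

Lemma infinite_dimensional_neq0 (R : realType) (k : scalar_kind)
  (H : normedModType (scalar_field R k)) :
  infinite_dimensional H -> exists x : H, x != 0.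
Proof.
move=> infH; have [x x0] := infH [::]; exists x; apply/eqP.
by have := x0 (fun=> 0); rewrite big_ord0.
Qed.

Theorem corollary2p11 (R : realType) (k : scalar_kind)
  (H : completeNormedModType (scalar_field R k)) (dot : {dot H for conj_scalar k})
  (normE : forall x : H, `|x| ^+ 2 = dot x x)
  (sepH : separable H) (infH : infinite_dimensional H)
  (T : {linear H -> H}) (cT : continuous T) :
  [<-> hypercyclicity_criterion T;
       exists n : nat -> nat, [/\ forall i, (0 < n i)%N,
         {homo n : i j / (i < j)%N} & hereditarily_hypercyclic T n];
       hypercyclic (l2sum_op cT);
       exists e : onb dot, hypercyclic (hs_lmul e cT);
       forall U V W : set H, open U -> U !=set0 -> open V -> V !=set0 ->
         nbhs 0 W ->
         exists n : nat, [/\ (0 < n)%N,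
           (iter n T @` U) `&` W !=set0 & (iter n T @` W) `&` V !=set0]].
Proof.
have [h dh] := separable_sequence 0 sepH.
have cH := @complete_sequentially R k H.
have nzH := infinite_dimensional_neq0 infH.
tfae.
- exact: criterion_hereditary cT _ dh cH.
- by move=> [n [n0 _ hT]]; exact: hereditary_l2sum_hypercyclic dh cH n0 hT.
- move=> hT; have [e oe] := ex_orthonormal_basis normE dh infH.
  by exists (Onb oe); apply/(hs_lmul_hypercyclic normE cH).
(* The cycle returns from (iv) to the direct sum before reaching (v). *)
- move=> [e /(hs_lmul_hypercyclic normE cH)].
  exact: l2sum_hypercyclic_three_open_sets.
- exact: three_open_sets_criterion dh cH.
Qed.
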